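(* Let $F$ be a formal group over $\mathbb{C}$, let $g(x)\in x\mathbb{C}[[x]]$ with $g'(0)=1$, and let $F_{g}$ be the formal group defined by $F_{g}(x,y)=g^{-1}(F(g(x),g(y)))$. Let $(V,Y,\mathbf{1})$ be a vertex $F$-algebra (resp. nonlocal vertex $F$-algebra). For $v\in V$, set $$Y_{g}(v,x)=Y(v,g(x)).$$ Then $(V,Y_{g},\mathbf{1})$ carries the structure of a vertex $F_{g}$-algebra (resp. nonlocal vertex $F_{g}$-algebra).
   Context: All vector spaces are over $\mathbb{C}$. A (one-dimensional) formal group over $\mathbb{C}$ is $F(x,y)\in\mathbb{C}[[x,y]]$ with $F(x,0)=x$, $F(0,y)=y$, $F(x,F(y,z))=F(F(x,y),z)$; it is automatically commutative. $g^{-1}$ denotes the compositional inverse of $g$. A nonlocal vertex $F$-algebra is a vector space $V$ with a linear map $Y(\cdot,x):V\to \mathrm{Hom}(V,V((x)))$, $v\mapsto Y(v,x)=\sum_{n\in\mathbb{Z}}v_nx^{-n-1}$, and a vector $\mathbf{1}\in V$ such that (vacuum and creation) $Y(\mathbf{1},x)v=v$, $Y(v,x)\mathbf{1}\in V[[x]]$ and $\lim_{x\to0}Y(v,x)\mathbf{1}=v$ for $v\in V$; (weak $F$-associativity) for $u,v,w\in V$ there exists a nonnegative integer $l$ such that $$F(x_0,x_2)^lY(u,F(x_0,x_2))Y(v,x_2)w=F(x_0,x_2)^lY(Y(u,x_0)v,x_2)w,$$ where in $Y(u,F(x_0,x_2))$ the powers $F(x_0,x_2)^m$, $m\in\mathbb{Z}$,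 are expanded in $\mathbb{C}((x_0))[[x_2]]$. A vertex $F$-algebra is a nonlocal vertex $F$-algebra satisfying weak commutativity: for $u,v\in V$ there exists a nonnegative integer $k$ with $(x_1-x_2)^kY(u,x_1)Y(v,x_2)=(x_1-x_2)^kY(v,x_2)Y(u,x_1)$. For $g(x)\in x\mathbb{C}[[x]]$ with $g'(0)=1$, $Y(v,g(x))=\sum_n v_n\,g(x)^{-n-1}$, where $g(x)^m\in x^m\mathbb{C}[[x]]$ for $m\in\mathbb{Z}$. *)

(* Defs.v *)
(* Conventions.
   - [fps A] is the ring A[[x]].  C[[x,y]] and C[[x,y,z]] are the iterated rings
     [fps (fps C)] and [fps (fps (fps C))], the outermost variable being the
     last one: the coefficient of x^i y^j in [F] is [F j i].
   - C((x)) is [{fraction fps C}] and C((x0))[[x2]] is [fps {fraction fps C}];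
     the integer powers taken there are the powers [_ ^ m] of the library for
     unit rings.
   - A vertex operator map is [Y : V -> int -> V -> V], with [Y v n w] = v_n w. *)
From HB Require Import structures.
From mathcomp Require Import all_boot all_order all_algebra fraction generic_quotient.
From mathcomp Require Import boolp classical_sets cardinality fsbigop reals.
From mathcomp Require Import complex zify.

Set Implicit Arguments.
Unset Strict Implicit.
Unset Printing Implicit Defensive.
Import GRing.Theory.
Local Open Scope ring_scope.

Record fps (A : Type) := Fps { fcoef :> nat -> A }.

Lemma fpsP (A : Type) (f g : fps A) : (forall n, f n = g n) <-> f = g.
Proof.
split=> [|-> //]; case: f g => [f] [g] /= fg.
by congr Fps; apply/funext.
Qed.

HB.instance Definition _ (A : Type) := gen_eqMixin (fps A).
HB.instance Definition _ (A : Type) := gen_choiceMixin (fps A).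

Definition fps_map (A B : Type) (h : A -> B) (f : fps A) : fps B :=
  Fps (fun n => h (f n)).

Section Zmodule.
Variable A : zmodType.
Implicit Types f g : fps A.

Definition fps_zero : fps A := Fps (fun=> 0).
Definition fps_opp f : fps A := Fps (fun n => - f n).
Definition fps_add f g : fps A := Fps (fun n => f n + g n).

Let addA : associative fps_add.
Proof. by move=> f g h; apply/fpsP => n /=; rewrite addrA. Qed.
Let addC : commutative fps_add.
Proof. by move=> f g; apply/fpsP => n /=; rewrite addrC. Qed.
Let add0 : left_id fps_zero fps_add.
Proof. by move=> f; apply/fpsP => n /=; rewrite add0r. Qed.
Let addN : left_inverse fps_zero fps_opp fps_add.
Proof. by move=> f; apply/fpsP => n /=; rewrite addNr. Qed.

HB.instance Definition _ := GRing.isZmodule.Build (fps A) addA addC add0 addN.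

Lemma fcoef0 n : (0 : fps A) n = 0. Proof. by []. Qed.
Lemma fcoefD f g n : (f + g) n = f n + g n. Proof. by []. Qed.
Lemma fcoefN f n : (- f) n = - f n. Proof. by []. Qed.
Lemma fcoefB f g n : (f - g) n = f n - g n. Proof. by []. Qed.

End Zmodule.

Section ComRing.
Variable A : comNzRingType.
Implicit Types f g h : fps A.

Definition fps_const (a : A) : fps A := Fps (fun n => if n == 0%N then a else 0).
Definition fps_mul f g : fps A :=
  Fps (fun n => \sum_(i < n.+1) f i * g (n - i)%N).

Definition fps_trunc N f : {poly A} := \poly_(i < N) f i.

Lemma fps_mul_trunc N f g n : (n < N)%N ->
  (fps_mul f g) n = (fps_trunc N f * fps_trunc N g)`_n.
Proof.
move=> nN; rewrite coefM /=; apply: eq_bigr => i _.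
by rewrite !coef_poly (leq_ltn_trans (leq_subr _ _) nN) (leq_trans (ltn_ord i) nN).
Qed.

Let mulA : associative fps_mul.
Proof.
move=> f g h; apply/fpsP => n; pose T := fps_trunc n.+1.
have lhs : (fps_mul f (fps_mul g h)) n = (T f * (T g * T h))`_n.
  rewrite coefM /=; apply: eq_bigr => i _.
  rewrite -(@fps_mul_trunc n.+1 g h) ?ltnS ?leq_subr //.
  by rewrite coef_poly ltn_ord.
have rhs : (fps_mul (fps_mul f g) h) n = (T f * T g * T h)`_n.
  rewrite coefM /=; apply: eq_bigr => i _.
  rewrite -(@fps_mul_trunc n.+1 f g) ?ltn_ord //.
  by rewrite coef_poly ltnS leq_subr.
by rewrite lhs rhs mulrA.
Qed.

Let mulC : commutative fps_mul.
Proof. by move=> f g; apply/fpsP => n; rewrite !(@fps_mul_trunc n.+1) // mulrC. Qed.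

Let mul1 : left_id (fps_const 1) fps_mul.
Proof.
move=> f; apply/fpsP => n /=; rewrite big_ord_recl /= mul1r subn0.
by rewrite big1 ?addr0 // => i _; rewrite mul0r.
Qed.

Let mulDl : left_distributive fps_mul +%R.
Proof.
move=> f g h; apply/fpsP => n /=; rewrite -big_split /=.
by apply: eq_bigr => i _; rewrite mulrDl.
Qed.

Let one_neq0 : fps_const 1 != 0.
Proof. by apply/eqP => /fpsP/(_ 0%N)/eqP; rewrite oner_eq0. Qed.

HB.instance Definition _ :=
  GRing.Zmodule_isComNzRing.Build (fps A) mulA mulC mul1 mulDl one_neq0.

Definition fps_X : fps A := Fps (fun n => (n == 1%N)%:R).

Lemma fcoef1 n : (1 : fps A) n = (n == 0%N)%:R.
Proof. by rewrite /GRing.one /=; case: eqP. Qed.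

Lemma fcoefM f g n : (f * g) n = \sum_(i < n.+1) f i * g (n - i)%N.
Proof. by []. Qed.

Lemma fcoefXnM k f n : (fps_X ^+ k * f) n = if (n < k)%N then 0 else f (n - k)%N.
Proof.
elim: k n => [|k IHk] n; first by rewrite expr0 mul1r subn0.
rewrite exprS -mulrA fcoefM big_ord_recl mul0r add0r; case: n => [|n].
  by rewrite big_ord0.
rewrite big_ord_recl big1 ?addr0 => [|i _]; last by rewrite mul0r.
by rewrite /= mul1r -fcoefM subn1 IHk ltnS subSS.
Qed.

End ComRing.

Section Unit.
Variable A : comUnitRingType.
Implicit Types f g : fps A.

Fixpoint fps_inv_seq f n : seq A :=
  if n is m.+1 then
    let s := fps_inv_seq f m in
    rcons s (if m is 0 then (f 0%N)^-1
             else - (f 0%N)^-1 * \sum_(i < m) f i.+1 * s`_(m - i.+1))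
  else [::].

Definition fps_unit : pred (fps A) := fun f => f 0%N \is a GRing.unit.
Definition fps_inv f : fps A :=
  if fps_unit f then Fps (fun n => (fps_inv_seq f n.+1)`_n) else f.

Lemma size_fps_inv_seq f n : size (fps_inv_seq f n) = n.
Proof. by elim: n => //= n IHn; rewrite size_rcons IHn. Qed.

Lemma nth_fps_inv_seq f n k :
  (k < n)%N -> (fps_inv_seq f n)`_k = (fps_inv_seq f k.+1)`_k.
Proof.
elim: n => // n IHn; rewrite ltnS leq_eqVlt => /predU1P[-> //|kn].
by rewrite {1}/fps_inv_seq -/fps_inv_seq nth_rcons size_fps_inv_seq kn IHn.
Qed.

Let mulVf : {in fps_unit, left_inverse 1 fps_inv *%R}.
Proof.
move=> f; rewrite unfold_in => fu; rewrite mulrC /fps_inv /fps_unit fu.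
apply/fpsP => -[|n]; rewrite fcoef1 fcoefM.
  by rewrite big_ord_recl big_ord0 addr0 /= divrr.
rewrite big_ord_recl subn0; set s := (X in f 0%N * X).
have -> : s = - (f 0%N)^-1 *
    \sum_(i < n.+1) f i.+1 * (fps_inv_seq f n.+1)`_(n.+1 - i.+1).
  rewrite /s; cbn -[fps_inv_seq].
  rewrite [fps_inv_seq f n.+2]/= -/(fps_inv_seq f n.+1).
  by rewrite nth_rcons size_fps_inv_seq ltnn eqxx.
rewrite mulrA mulrN divrr // mulN1r; apply/eqP; rewrite addrC subr_eq0; apply/eqP.
apply: eq_bigr => i _; congr (_ * _).
by rewrite [in RHS]nth_fps_inv_seq //= subSS ltnS leq_subr.
Qed.

Let unitPl f g : g * f = 1 -> fps_unit f.
Proof.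
move=> /fpsP/(_ 0%N); rewrite fcoefM fcoef1 big_ord_recl big_ord0 addr0 /= => gf.
by apply/unitrPr; exists (g 0%N); rewrite mulrC.
Qed.

Let inv_out : {in [predC fps_unit], fps_inv =1 id}.
Proof. by move=> f; rewrite inE unfold_in /fps_inv /fps_unit => /negPf ->. Qed.

HB.instance Definition _ :=
  GRing.ComNzRing_hasMulInverse.Build (fps A) mulVf unitPl inv_out.

Lemma fps_unitE f : (f \is a GRing.unit) = (f 0%N \is a GRing.unit).
Proof. by []. Qed.

End Unit.

Section Domain.
Variable A : idomainType.
Implicit Types f g : fps A.

Lemma fps_factorX f : f != 0 -> exists k h, f = fps_X A ^+ k * h /\ h 0%N != 0.
Proof.
move=> f0; have exf : exists n, f n != 0.
  apply: contrapT => /forallNP f_eq0; case/eqP: f0; apply/fpsP => n.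
  by apply/eqP/negPn/negP/f_eq0.
case: (ex_minnP exf) => k fk kmin; exists k, (Fps (fun n => f (n + k)%N)); split=> //.
apply/fpsP => n; rewrite fcoefXnM /=; case: ltnP => nk; last by rewrite subnK.
by apply/eqP/negPn/negP => /kmin; rewrite leqNgt nk.
Qed.

Let fps_idomain f g : f * g = 0 -> (f == 0) || (g == 0).
Proof.
move=> fg; apply/norP => -[/fps_factorX[k [f1 [fE f10]]]].
move=> /fps_factorX[l [g1 [gE g10]]].
have : (fps_X A ^+ (k + l) * (f1 * g1)) (k + l)%N = 0.
  by rewrite exprD mulrACA -fE -gE fg.
rewrite fcoefXnM ltnn subnn fcoefM big_ord_recl big_ord0 addr0 => /eqP.
by rewrite mulf_eq0 (negPf f10) (negPf g10).
Qed.

HB.instance Definition _ :=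
  GRing.ComUnitRing_isIntegral.Build (fps A) fps_idomain.

End Domain.

Lemma fractionP (R : idomainType) (f : {fraction R}) :
  exists a b : R, b != 0 /\ f = tofrac a / tofrac b.
Proof.
elim/quotW: f => x; exists (frac x).1, (frac x).2; have x0 := denom_ratioP x.
split=> //; apply/(mulIf (x := tofrac (frac x).2)); first by rewrite tofrac_eq0.
rewrite divfK ?tofrac_eq0 //; unlock FracField.tofrac.
rewrite -[LHS]FracField.pi_mul; apply/eqmodP => /=.
rewrite FracField.equivfE /FracField.mulf !numden_Ratio ?mulr1 ?oner_eq0 //.
by rewrite mulrC.
Qed.

Notation laurent K := {fraction fps K}.

Section Laurent.
Variable K : fieldType.
Implicit Types (f : laurent K) (p : fps K).

Lemma tofrac_X_neq0 : tofrac (fps_X K) != 0.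
Proof.
by rewrite tofrac_eq0; apply/eqP => /fpsP/(_ 1%N)/eqP; rewrite oner_eq0.
Qed.

Lemma laurentP f : exists kp : nat * fps K,
  f = tofrac (fps_X K) ^- kp.1 * tofrac kp.2.
Proof.
have [a [b [b0 ->]]] := fractionP f.
have [k [h [-> h0]]] := fps_factorX b0.
exists (k, a * h^-1) => /=; have hu : h \is a GRing.unit by rewrite fps_unitE unitfE.
have h0' : tofrac h != 0 by rewrite tofrac_eq0; apply: contraTneq hu => ->; rewrite unitr0.
rewrite !tofracM tofracXn invfM mulrCA; congr (_ * (_ * _)).
by apply: (mulIf h0'); rewrite mulVf // -tofracM mulVr // tofrac1.
Qed.

(* The coefficient of x^n in f, for n in Z; see lcoefE. *)
Definition lcoef f (n : int) : K :=
  let kp := xget (0%N, 0)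
    [set kp : nat * fps K | f = tofrac (fps_X K) ^- kp.1 * tofrac kp.2] in
  if n + Posz kp.1 is Posz j then kp.2 j else 0.

Lemma lcoefE k p n :
  lcoef (tofrac (fps_X K) ^- k * tofrac p) n =
  if n + Posz k is Posz j then p j else 0.
Proof.
rewrite /lcoef; case: xgetP => [[l q] _ /= e|/(_ (k, p)) []//].
have X0 := tofrac_X_neq0.
have {}e : fps_X K ^+ l * p = fps_X K ^+ k * q.
  apply/eqP; rewrite -tofrac_eq !tofracM !tofracXn; apply/eqP.
  move/(congr1 (fun z => tofrac (fps_X K) ^+ l * (tofrac (fps_X K) ^+ k * z))): e.
  rewrite mulVKf ?expf_neq0 // => ->; rewrite mulrCA mulVKf ?expf_neq0 //.
have shiftE (r : fps K) (m : int) (d N : nat) : m + Posz d = Posz N ->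
    (if m is Posz j then r j else 0) = (fps_X K ^+ d * r) N.
  rewrite fcoefXnM; case: m => j mN.
    by have [-> ->] : (N < d)%N = false /\ (N - d)%N = j by split; lia.
  by have -> : (N < d)%N by lia.
case nlk : (n + Posz l + Posz k) => [N|N].
  by rewrite (shiftE _ _ _ _ nlk) (shiftE p (n + Posz k) l N) ?e //; lia.
case nl : (n + Posz l) => [i|i]; first by exfalso; lia.
by case nk : (n + Posz k) => [j|j] //; exfalso; lia.
Qed.

End Laurent.

Local Open Scope classical_set_scope.

(* Coefficientwise sums of families of power series, and substitutions
   sum_k g_k h^k and sum_(i,j) F_ij a^i b^j.  These sums are locally finite
   when the series substituted have no constant term. *)
Section Substitution.
Variable K : comNzRingType.

Definition fps_sum1 (T : choiceType) (s : T -> fps K) : fps K :=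
  Fps (fun i => \sum_(t \in [set: T]) s t i).
Definition fps_sum2 (T : choiceType) (s : T -> fps (fps K)) : fps (fps K) :=
  Fps (fun j => fps_sum1 (fun t => s t j)).
Definition fps_sum3 (T : choiceType) (s : T -> fps (fps (fps K))) :
    fps (fps (fps K)) :=
  Fps (fun k => fps_sum2 (fun t => s t k)).

Definition const2 (c : K) : fps (fps K) := fps_const (fps_const c).
Definition const3 (c : K) : fps (fps (fps K)) := fps_const (const2 c).

Definition fps_comp (g h : fps K) : fps K :=
  fps_sum1 (fun k : nat => fps_const (g k) * h ^+ k).
Definition fps_comp2 (g : fps K) (h : fps (fps K)) : fps (fps K) :=
  fps_sum2 (fun k : nat => const2 (g k) * h ^+ k).
Definition subst2 (F a b : fps (fps K)) : fps (fps K) :=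
  fps_sum2 (fun ij : nat * nat =>
    const2 (F ij.2 ij.1) * a ^+ ij.1 * b ^+ ij.2).
Definition subst3 (F : fps (fps K)) (a b : fps (fps (fps K))) :
    fps (fps (fps K)) :=
  fps_sum3 (fun ij : nat * nat =>
    const3 (F ij.2 ij.1) * a ^+ ij.1 * b ^+ ij.2).

(* Exists and is unique when g(0) = 0 and g'(0) is invertible. *)
Definition compinv (g : fps K) : fps K :=
  xget 0 [set h : fps K | [/\ h 0%N = 0, fps_comp g h = fps_X K
                            & fps_comp h g = fps_X K]].

(* F(x, 0) is the coefficient of y^0; the two sides of fg_assoc are
   F(x, F(y, z)) and F(F(x, y), z). *)
Record formal_group (F : fps (fps K)) : Prop := FormalGroup {
  fg_x0 : F 0%N = fps_X K;
  fg_0y : fps_map (fun p : fps K => p 0%N) F = fps_X K;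
  fg_assoc :
    subst3 F (fps_const (fps_const (fps_X K)))
             (fps_map (fps_map (@fps_const K)) F) =
    subst3 F (fps_const F) (fps_X (fps (fps K)))
}.

(* F_g(x, y) = g^-1(F(g(x), g(y))) *)
Definition fg_change (F : fps (fps K)) (g : fps K) : fps (fps K) :=
  fps_comp2 (compinv g) (subst2 F (fps_const g) (fps_map (@fps_const K) g)).

End Substitution.

Section VertexAlgebra.
Variables (K : fieldType) (V : lmodType K).
Implicit Types (F : fps (fps K)) (Y : V -> int -> V -> V).

(* F(x0, x2)^m expanded in K((x0))[[x2]]; F(x0, x2) is a unit of that ring
   because F(x0, 0) = x0. *)
Definition fg_pow F (m : int) : fps (laurent K) :=
  (fps_map (@FracField.tofrac (fps K)) F) ^ m.

(* The coefficient of x0^a x2^b. *)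
Definition lcoef2 (f : fps (laurent K)) (a b : int) : K :=
  if b is Posz j then lcoef (f j) a else 0.

(* Series in V[[x^+-1, y^+-1]] are maps int -> int -> V, and fps2_scale
   multiplies them by an element of K[[x,y]].  In the uses of these sums below
   only finitely many terms are nonzero: in weak associativity by truncation
   (v_n w = 0 for n large) and because the coefficient of x2^j in F(x0, x2)^m is
   in x0^(m - j) K[[x0]], in weak commutativity because (x1 - x2)^k is a
   polynomial. *)
Definition fps2_scale (f : fps (fps K)) (A : int -> int -> V) (a b : int) : V :=
  \sum_(ij \in [set: nat * nat])
    f ij.2 ij.1 *: A (a - Posz ij.1) (b - Posz ij.2).

(* Y(u, x1) Y(v, x2) w *)
Definition vprod Y (u v w : V) (a b : int) : V :=
  Y u (- a - 1) (Y v (- b - 1) w).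

(* Y(u, F(x0, x2)) Y(v, x2) w
   = sum_(m,n) F(x0, x2)^(- m - 1) x2^(- n - 1) u_m v_n w *)
Definition vprodF F Y (u v w : V) (a b : int) : V :=
  \sum_(mn \in [set: int * int])
    lcoef2 (fg_pow F (- mn.1 - 1)) a (b + mn.2 + 1) *: Y u mn.1 (Y v mn.2 w).

(* Y(Y(u, x0) v, x2) w *)
Definition viter Y (u v w : V) (a b : int) : V :=
  Y (Y u (- a - 1) v) (- b - 1) w.

Record nonlocal_vertex_algebra F Y (vac : V) : Prop := NonlocalVertexAlgebra {
  va_linearl : forall n w, linear (fun v => Y v n w);
  va_linearr : forall v n, linear (Y v n);
  va_truncation : forall v w, exists N : int, forall n, N <= n -> Y v n w = 0;
  va_vacuum : forall n w, Y vac n w = if n == -1 then w else 0;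
  va_creation : forall v (n : nat), Y v (Posz n) vac = 0;
  va_creation_lim : forall v, Y v (-1) vac = v;
  va_weak_assoc : forall u v w, exists l : nat, forall a b,
    fps2_scale (F ^+ l) (vprodF F Y u v w) a b =
    fps2_scale (F ^+ l) (viter Y u v w) a b
}.

Record vertex_algebra F Y (vac : V) : Prop := VertexAlgebra {
  va_nonlocal : nonlocal_vertex_algebra F Y vac;
  va_weak_comm : forall u v, exists k : nat, forall w a b,
    let x1 := fps_const (fps_X K) in let x2 := fps_X (fps K) in
    fps2_scale ((x1 - x2) ^+ k) (vprod Y u v w) a b =
    fps2_scale ((x1 - x2) ^+ k) (fun a b => vprod Y v u w b a) a b
}.

(* Y_g(v, x) = Y(v, g(x)) = sum_m g(x)^(- m - 1) v_m; its n-th mode is the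
   coefficient of x^(- n - 1).  The powers of g are taken in K((x)); the sum is
   finite since g(x)^(- m - 1) is in x^(- m - 1) K[[x]] and v_m w = 0 for m
   large. *)
Definition vchange (g : fps K) Y (v : V) (n : int) (w : V) : V :=
  \sum_(m \in [set: int])
    lcoef (FracField.tofrac g ^ (- m - 1)) (- n - 1) *: Y v m w.

End VertexAlgebra.

(* Main.v *)
(* The change of variable x -> g(x) is read off its kernel
   k(p, q; a, b) = [x^a y^b] g(x)^p g(y)^q, for p, q in Z, and so is the
   substitution (x, y) -> (F(x, y), y).  A kernel is determined by the two series
   alpha, beta in K[[x, y]] it substitutes: multiplying its (p, q)-th row by alpha
   (resp. beta) gives the row (p + 1, q) (resp. (p, q + 1)), and both
   multiplications are injective on series bounded below.  Hence the two composites
   (F(x, y), y) o (g, g) and (g, g) o (F_g(x, y), y) agree, since both substitute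
   F(g(x), g(y)) = g(F_g(x, y)) and g(y); this is
   Y_g(u, F_g(x, y)) Y_g(v, y) w = (Y(u, F(x, y)) Y(v, y) w)(g(x), g(y)).
   As F_g is a multiple of F(g(x), g(y)), and x - y is a multiple of g(x) - g(y),
   weak associativity and weak commutativity follow from those of Y by
   substituting g(x), g(y). *)
From HB Require Import structures.
Require Import Defs.
From mathcomp Require Import all_boot all_order all_algebra fraction.
From mathcomp Require Import boolp classical_sets cardinality fsbigop reals.
From mathcomp Require Import complex zify.

Set Implicit Arguments.
Unset Strict Implicit.
Unset Printing Implicit Defensive.
Import Order.TTheory GRing.Theory Num.Theory.
Local Open Scope ring_scope.
Local Open Scope complex_scope.
Local Open Scope classical_set_scope.

(** * Finite sums *)

(** Products lie in V((x))((y)) and iterates in V((y))((x)), and negative powers of F(x, y) are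
    expanded in one of the two ways only, so the substitution cannot be handled as a single ring
    morphism applied to everything. On power series it can: a morphism that sends the variables into
    the first ideal of a filtration is fixed by their images, continuity being automatic, and the
    identities relating F, g and F_g are obtained that way. Kernels transport them to integer
    exponents without ever comparing expansions of negative powers of F(g(x), g(y)) and g(F_g(x,
    y)). The sum operator returns 0 on an infinite support, so exchanging or splitting sums calls
    for explicit bounds; [below] and [lower_finite] supply them. The exponents in weak associativity
    and weak commutativity do not change, because F_g / F(g(x), g(y)) and (x - y) / (g(x) - g(y))
    are power series. *)

Class sized (T : choiceType) := Sized {
  ht : T -> nat;
  box : nat -> seq T;
  box_uniq : forall N, uniq (box N);
  mem_box : forall N t, (t \in box N) = (ht t <= N)%N
}.

#[global] Instance sized_nat : sized nat.
Proof.
by exists id (fun N => iota 0 N.+1) => N *; rewrite ?iota_uniq ?mem_iota.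
Defined.

#[global] Instance sized_int : sized int.
Proof.
(* [Negz n] has absolute value n + 1, hence one entry fewer than on the [Posz] side. *)
exists absz (fun N => map Posz (iota 0 N.+1) ++ map Negz (iota 0 N)) => N.
  rewrite cat_uniq !map_inj_uniq ?iota_uniq ?andbT => [|i j []//|i j []//].
  by apply/hasP => -[z /mapP[i _ ->]] /mapP[].
have PosP n (s : seq nat) : (Posz n \in map Posz s) = (n \in s).
  by apply: mem_map => i j [].
have NegP n (s : seq nat) : (Negz n \in map Negz s) = (n \in s).
  by apply: mem_map => i j [].
move=> [n|n]; rewrite mem_cat ?PosP ?NegP mem_iota add0n.
  by rewrite (_ : (Posz n \in map Negz _) = false) ?orbF //; apply/mapP => -[].
by rewrite (_ : (Negz n \in map Posz _) = false) //; apply/mapP => -[].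
Defined.

#[global] Instance sized_prod (T U : choiceType) (ST : sized T) (SU : sized U) :
  sized (T * U)%type.
Proof.
exists (fun p => (ht p.1 + ht p.2)%N)
  (fun N => [seq p <- [seq (t, u) | t <- box N, u <- box N] | ht p.1 + ht p.2 <= N]%N) => N.
  by rewrite filter_uniq // allpairs_uniq ?box_uniq // => -[a b] [c d].
move=> [t u]; rewrite mem_filter /= andbC.
case: leqP => [le|_]; last by rewrite andbF.
rewrite andbT; apply/allpairsP; exists (t, u); rewrite /= !mem_box; split=> //.
  exact: leq_trans (leq_addr _ _) le.
exact: leq_trans (leq_addl _ _) le.
Defined.

Section FiniteSums.
Context (V : zmodType) (T : choiceType) {ST : sized T}.

Lemma fsum_seq (f : T -> V) (s : seq T) : uniq s ->
  (forall t, f t <> 0 -> t \in s) ->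
  \sum_(t \in [set: T]) f t = \sum_(t <- s) f t.
Proof.
move=> us fs; rewrite (fsbigE s) //=.
  by apply: eq_bigl => t; rewrite in_setT.
by move=> t _; apply: contraNeq => /eqP; apply: fs.
Qed.

(** Finite support is expressed as a bound on [ht], so that it becomes an arithmetic goal and
    several sums can share one index list. *)
Lemma fsum_box (f : T -> V) N : (forall t, f t <> 0 -> (ht t <= N)%N) ->
  \sum_(t \in [set: T]) f t = \sum_(t <- box N) f t.
Proof. by move=> fN; apply: fsum_seq (box_uniq _) _ => t /fN; rewrite mem_box. Qed.

Lemma fsum1 (f : T -> V) t0 : (forall t, f t <> 0 -> t = t0) ->
  \sum_(t \in [set: T]) f t = f t0.
Proof.
move=> ft0; rewrite (@fsum_seq f [:: t0]) ?big_seq1 // => t /ft0 ->.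
exact: mem_head.
Qed.

Lemma fsum0 (f : T -> V) : (forall t, f t = 0) -> \sum_(t \in [set: T]) f t = 0.
Proof. by move=> f0; apply: fsbig1 => t _; apply: f0. Qed.

Lemma fsum_neq0 (f : T -> V) : \sum_(t \in [set: T]) f t <> 0 -> exists t, f t <> 0.
Proof. by move=> f0; apply: contrapT => /forallNP f1; apply: f0; apply: fsum0 => t; apply: contrapT. Qed.

Lemma eq_fsum (f g : T -> V) : (forall t, f t = g t) ->
  \sum_(t \in [set: T]) f t = \sum_(t \in [set: T]) g t.
Proof. by move=> fg; apply: eq_fsbigr => t _; apply: fg. Qed.

Lemma fsumD (f g : T -> V) N : (forall t, f t <> 0 \/ g t <> 0 -> (ht t <= N)%N) ->
  \sum_(t \in [set: T]) (f t + g t) =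
  \sum_(t \in [set: T]) f t + \sum_(t \in [set: T]) g t.
Proof.
move=> fgN; rewrite !(@fsum_box _ N) ?big_split // => t nz; apply: fgN; auto.
by apply: contrapT => /not_orP[/contrapT f0 /contrapT g0]; rewrite f0 g0 addr0 in nz.
Qed.

End FiniteSums.

Section DoubleSums.
Context (V : zmodType) (T U : choiceType) {ST : sized T} {SU : sized U}.

Lemma exchange_fsum (f : T -> U -> V) N :
  (forall t u, f t u <> 0 -> (ht t <= N)%N /\ (ht u <= N)%N) ->
  \sum_(t \in [set: T]) \sum_(u \in [set: U]) f t u =
  \sum_(u \in [set: U]) \sum_(t \in [set: T]) f t u.
Proof.
move=> fN; have eT t : \sum_(u \in [set: U]) f t u = \sum_(u <- box N) f t u.
  by apply: fsum_seq (box_uniq _) _ => u /fN[]; rewrite mem_box.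
have eU u : \sum_(t \in [set: T]) f t u = \sum_(t <- box N) f t u.
  by apply: fsum_seq (box_uniq _) _ => t /fN[]; rewrite mem_box.
under eq_fsum do rewrite eT; rewrite (fsum_box (N := N)).
  rewrite exchange_big /= (fsum_seq (s := box N)) ?box_uniq //.
    by apply: eq_bigr => u _.
  by move=> u /fsum_neq0[t /fN[]]; rewrite mem_box.
by move=> t; rewrite -eT => /fsum_neq0[u /fN[]].
Qed.

Lemma pair_fsum (f : T -> U -> V) N :
  (forall t u, f t u <> 0 -> (ht t <= N)%N /\ (ht u <= N)%N) ->
  \sum_(t \in [set: T]) \sum_(u \in [set: U]) f t u =
  \sum_(p \in [set: T * U]) f p.1 p.2.
Proof.
move=> fN.
have eT t : \sum_(u \in [set: U]) f t u = \sum_(u <- box N) f t u.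
  by apply: fsum_seq (box_uniq _) _ => u /fN[]; rewrite mem_box.
rewrite (fsum_box (N := N)) => [|t].
  under eq_bigr do rewrite eT.
  rewrite -(big_allpairs (F := fun p : T * U => f p.1 p.2)) [RHS](fsbigE [seq (t, u) | t <- box N, u <- box N]) //=.
  - by apply: eq_bigl => t; rewrite in_setT.
  - by rewrite allpairs_uniq ?box_uniq // => -[a b] [c d].
  move=> [t u] _; apply: contraNeq => /eqP/fN[/= tN uN].
  by apply/allpairsP; exists (t, u); rewrite /= !mem_box.
by move=> /fsum_neq0[u /fN[]].
Qed.

(** The change of index behind the shifts of exponents and the passage from modes to exponents. *)
Lemma fsum_inj (h : T -> U) (f : U -> V) : injective h ->
  (forall u, f u <> 0 -> exists t, u = h t) ->
  \sum_(t \in [set: T]) f (h t) = \sum_(u \in [set: U]) f u.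
Proof.
move=> hI fh; rewrite -(@fsbig_widen _ _ _ _ (range h)) //=.
  by rewrite fsbig_image // => x y _ _; apply: hI.
move=> u [_ /=]; apply: contra_notP => /fh[t ->]; by exists t.
Qed.

End DoubleSums.

Lemma fsum_morph (V W : zmodType) (T : choiceType) (ST : sized T) (phi : V -> W)
    (f : T -> V) N :
  phi 0 = 0 -> {morph phi : u v / u + v} ->
  (forall t, f t <> 0 -> (ht t <= N)%N) ->
  phi (\sum_(t \in [set: T]) f t) = \sum_(t \in [set: T]) phi (f t).
Proof.
move=> phi0 phiD fN; rewrite !(@fsum_box _ _ _ _ N) //.
  by elim: (box N) => [|t s IHs]; rewrite ?big_nil // !big_cons phiD IHs.
by move=> t nz; apply: fN => ft; rewrite ft in nz.
Qed.

Lemma fsum_ord2 (V : zmodType) (f : nat -> nat -> V) m n :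
  (forall i j, f i j <> 0 -> (i < m)%N /\ (j < n)%N) ->
  \sum_(p \in [set: nat * nat]) f p.1 p.2 = \sum_(j < n) \sum_(i < m) f i j.
Proof.
move=> fmn; rewrite exchange_big /=.
rewrite (@fsum_seq _ _ _ [seq (i, j) | i <- iota 0 m, j <- iota 0 n]).
- rewrite (big_allpairs (F := fun p => f p.1 p.2)) -[m in LHS]subn0.
  rewrite -/(index_iota 0 m) big_mkord; apply: eq_bigr => i _.
  by rewrite -[n in LHS]subn0 -/(index_iota 0 n) big_mkord.
- by rewrite allpairs_uniq ?iota_uniq // => -[a b] [c d].
move=> [i j] /fmn[/= im jn]; apply/allpairsP; exists (i, j) => /=.
by rewrite !mem_iota.
Qed.

(** * Substitution in formal power series *)

(* A ring with a separated filtration by ideals and a summation operator; an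
   element of [ideal 1] can be substituted in power series. *)
Record adic (B : comNzRingType) := Adic {
  ideal : nat -> B -> Prop;
  tsum : forall T : choiceType, (T -> B) -> B;
  ideal_0 : forall N, ideal N 0;
  idealB : forall N a b, ideal N a -> ideal N b -> ideal N (a - b);
  idealM : forall M N a b, ideal M a -> ideal N b -> ideal (M + N) (a * b);
  idealT : forall a, ideal 0 a;
  ideal_le : forall M N a, (M <= N)%N -> ideal N a -> ideal M a;
  ideal_sep : forall a, (forall N, ideal N a) -> a = 0;
  tsum_seq : forall (T : choiceType) (s : T -> B) (A : seq T) N, uniq A ->
    (forall t, ~ ideal N (s t) -> t \in A) ->
    ideal N (tsum s - \sum_(t <- A) s t)
}.

Lemma fcoef_sum (A : zmodType) (I : Type) (r : seq I) (P : pred I) (F : I -> fps A) n :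
  (\sum_(i <- r | P i) F i) n = \sum_(i <- r | P i) F i n.
Proof. by elim/big_rec2: _ => [//|i y x _ <-]. Qed.

(** The discrete filtration, zero above level 0. Its [tsum] is chosen so that [fps_sum1], [fps_sum2]
    and [fps_sum3] unfold to the [tsum] of the iterated [adic_fps]. *)
Definition adic_base (K : comNzRingType) : adic K.
Proof.
exists (fun N a => (0 < N)%N -> a = 0)
       (fun (T : choiceType) s => \sum_(t \in [set: T]) s t) => //.
- by move=> N a b a0 b0 N0; rewrite a0 ?b0 ?subr0.
- move=> [|M] N a b a0 b0; last by rewrite a0 ?mul0r.
  by move=> /b0 ->; rewrite mulr0.
- by move=> M N a MN a0 M0; apply: a0; apply: leq_trans MN.
- by move=> a /(_ 1%N); apply.
move=> T s A N uA sA N0; rewrite (fsum_seq uA) ?subrr // => t st.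
by apply: sA => /(_ N0).
Defined.

(** Filtration by total degree: the new variable has degree 1, so coefficient n owes only N - n
    levels, and none from n = N on. *)
Definition adic_fps (B : comNzRingType) (S : adic B) : adic (fps B).
Proof.
exists (fun N (f : fps B) => forall n, ideal S (N - n)%N (f n))
       (fun (T : choiceType) (s : T -> fps B) => Fps (fun n => tsum S (fun t => s t n))).
- by move=> N n; apply: ideal_0.
- by move=> N f g f0 g0 n; apply: idealB.
- move=> M N f g f0 g0 n; rewrite fcoefM.
  elim/big_rec: _ => [|i x _ x0]; first exact: ideal_0.
  rewrite -[x]opprK -[- x]sub0r.
  apply: idealB; last by apply: idealB => //; apply: ideal_0.
  apply: ideal_le (idealM (f0 i) (g0 (n - i)%N)).
  by have := ltn_ord i; lia.
- by move=> f n; rewrite sub0n; apply: idealT.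
- by move=> M N f MN f0 n; apply: ideal_le (f0 n); rewrite leq_sub2r.
- move=> f f0; apply/fpsP => n; apply: (@ideal_sep _ S) => N.
  by have := f0 (N + n)%N n; rewrite addnK.
move=> T s A N uA sA n; rewrite fcoefB fcoef_sum; apply: tsum_seq => // t st.
by apply: sA => /(_ n).
Defined.

(** * Congruences modulo the ideals of a filtration *)

Section Adic.
Variables (B : comNzRingType) (S : adic B).
Implicit Types a b : B.
Local Notation I := (ideal S).

Lemma idealN N a : I N a -> I N (- a).
Proof. by move=> Ia; rewrite -sub0r; apply: idealB => //; apply: ideal_0. Qed.

Lemma idealD N a b : I N a -> I N b -> I N (a + b).
Proof. by move=> Ia Ib; rewrite -[b]opprK; apply/idealB/idealN. Qed.

Lemma ideal_mulr N a b : I N a -> I N (a * b).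
Proof. by move=> Ia; rewrite -[N]addn0; apply/idealM/idealT. Qed.

Lemma ideal_mull N a b : I N b -> I N (a * b).
Proof. by rewrite mulrC; apply: ideal_mulr. Qed.

Lemma idealX N a n : I 1 a -> (N <= n)%N -> I N (a ^+ n).
Proof.
move=> Ia Nn; apply: (ideal_le Nn).
elim: n {Nn} => [|n IHn]; first exact: idealT.
by rewrite exprS -add1n; apply: idealM.
Qed.

Lemma ideal_sum N (T : Type) (r : seq T) (P : pred T) (s : T -> B) :
  (forall t, P t -> I N (s t)) -> I N (\sum_(t <- r | P t) s t).
Proof. by move=> Is; elim/big_ind: _ => //; [apply: ideal_0 | move=> *; apply: idealD]. Qed.

Lemma ideal_trans N a b c : I N (a - b) -> I N (b - c) -> I N (a - c).
Proof. by move=> ab bc; rewrite -(subrKA b); apply: idealD. Qed.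

Lemma ideal_sym N a b : I N (a - b) -> I N (b - a).
Proof. by move=> ab; rewrite -opprB; apply: idealN. Qed.

Lemma ideal_congM N a a' b b' : I N (a - a') -> I N (b - b') -> I N (a * b - a' * b').
Proof.
move=> aa bb; rewrite -(subrKA (a' * b)) -mulrBl -mulrBr.
by apply: idealD; [apply: ideal_mulr | apply: ideal_mull].
Qed.

Lemma ideal_eq a b : (forall N, I N (a - b)) -> a = b.
Proof. by move=> ab; apply/eqP; rewrite -subr_eq0; apply/eqP/(@ideal_sep _ S). Qed.

End Adic.

Lemma fps_const_is_zmod_morphism (A : comNzRingType) : zmod_morphism (@fps_const A).
Proof. by move=> a b; apply/fpsP => -[|n] //; rewrite fcoefB /= subr0. Qed.
Lemma fps_const_is_monoid_morphism (A : comNzRingType) : monoid_morphism (@fps_const A).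
Proof.
split=> [//|a b]; apply/fpsP => -[|n]; rewrite fcoefM big_ord_recl.
  by rewrite big_ord0 addr0.
by rewrite big1 /= ?mulr0 ?addr0 // => i _; rewrite mul0r.
Qed.
HB.instance Definition _ (A : comNzRingType) :=
  GRing.isZmodMorphism.Build A (fps A) (@fps_const A) (@fps_const_is_zmod_morphism A).
HB.instance Definition _ (A : comNzRingType) :=
  GRing.isMonoidMorphism.Build A (fps A) (@fps_const A) (@fps_const_is_monoid_morphism A).

Section MapMorphism.
Variables (A B : comNzRingType) (h : {rmorphism A -> B}).

Lemma fps_map_is_zmod_morphism : zmod_morphism (fps_map h).
Proof. by move=> f g; apply/fpsP => n; rewrite fcoefB -[LHS]/(h ((f - g) n)) fcoefB rmorphB. Qed.
Lemma fps_map_is_monoid_morphism : monoid_morphism (fps_map h).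
Proof.
split=> [|f g]; apply/fpsP => n.
  by rewrite -[LHS]/(h ((1 : fps A) n)) !fcoef1 rmorph_nat.
by rewrite -[LHS]/(h ((f * g) n)) !fcoefM rmorph_sum; apply: eq_bigr => i _; rewrite rmorphM.
Qed.
HB.instance Definition _ :=
  GRing.isZmodMorphism.Build (fps A) (fps B) (fps_map h) fps_map_is_zmod_morphism.
HB.instance Definition _ :=
  GRing.isMonoidMorphism.Build (fps A) (fps B) (fps_map h) fps_map_is_monoid_morphism.

Lemma fps_mapX : fps_map h (fps_X A) = fps_X B.
Proof. by apply/fpsP => n /=; rewrite rmorph_nat. Qed.
Lemma fps_map_const a : fps_map h (fps_const a) = fps_const (h a).
Proof. by apply/fpsP => -[|n] //=; rewrite rmorph0. Qed.
End MapMorphism.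

(** A name for the coefficient, so that setting the variable to 0 can carry a morphism structure. *)
Definition constant_term (A : Type) (f : fps A) : A := f 0%N.
Section ConstantTerm.
Variables (A : comNzRingType).
Lemma constant_term_is_zmod_morphism : zmod_morphism (@constant_term A).
Proof. by []. Qed.
Lemma constant_term_is_monoid_morphism : monoid_morphism (@constant_term A).
Proof. by split=> // f g; rewrite /constant_term fcoefM big_ord_recl big_ord0 addr0. Qed.
HB.instance Definition _ :=
  GRing.isZmodMorphism.Build (fps A) A (@constant_term A) constant_term_is_zmod_morphism.
HB.instance Definition _ :=
  GRing.isMonoidMorphism.Build (fps A) A (@constant_term A) constant_term_is_monoid_morphism.
End ConstantTerm.

Lemma fps_split (A : comNzRingType) (f : fps A) N :
  f = \sum_(k < N) fps_const (f k) * fps_X A ^+ k +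
      fps_X A ^+ N * Fps (fun n => f (n + N)%N).
Proof.
apply/fpsP => n; rewrite fcoefD fcoefXnM fcoef_sum.
have term k : (fps_const (f k) * fps_X A ^+ k) n = if n == k then f k else 0.
  rewrite mulrC fcoefXnM /=; case: ltngtP => // kn; last by rewrite kn subnn.
  by rewrite subn_eq0 leqNgt kn.
under eq_bigr do rewrite term; case: ltnP => nN /=.
  rewrite (bigD1 (Ordinal nN)) //= eqxx big1 ?addr0 // => i.
  by rewrite -val_eqE /= eq_sym => /negPf ->.
rewrite subnK // big1 ?add0r // => i _; case: eqP => // ni.
by have := ltn_ord i; rewrite -ni ltnNge nN.
Qed.

(** * Evaluation of a power series as a ring morphism *)

Section Evaluation.
Variables (A B : comNzRingType) (S : adic B).
Local Notation I := (ideal S).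

Definition fps_eval (phi : A -> B) (b : B) (f : fps A) : B :=
  tsum S (fun k : nat => phi (f k) * b ^+ k).

(** Reduces statements about [fps_eval] to partial sums: they are checked modulo every ideal, and
    [ideal_eq] concludes by separation. *)
Lemma fps_eval_trunc phi b f N : I 1 b ->
  I N (fps_eval phi b f - \sum_(k < N) phi (f k) * b ^+ k).
Proof.
move=> Ib.
rewrite -(big_mkord predT (fun k => phi (f k) * b ^+ k)) /index_iota subn0.
apply: tsum_seq; first exact: iota_uniq.
move=> k nI; rewrite mem_iota add0n /=; case: ltnP => // Nk.
by case: nI; apply/ideal_mull/idealX.
Qed.

Variables (phi : {rmorphism A -> B}) (b : B) (Ib : I 1 b).

Lemma horner_map_trunc (p : {poly A}) N :
  I N ((map_poly phi p).[b] - \sum_(k < N) phi p`_k * b ^+ k).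
Proof.
rewrite -{1}[p](poly_take_drop N) rmorphD rmorphM /= map_polyXn hornerD hornerM hornerXn.
have -> : (map_poly phi (take_poly N p)).[b] = \sum_(k < N) phi p`_k * b ^+ k.
  rewrite (@horner_coef_wide _ N).
    by apply: eq_bigr => k _; rewrite coef_map coef_take_poly ltn_ord.
  by apply: leq_trans (size_poly _ _) (size_take_poly _ _).
by rewrite addrAC subrr add0r; apply/ideal_mull/idealX.
Qed.

Lemma fps_eval_horner (f : fps A) N :
  I N (fps_eval phi b f - (map_poly phi (fps_trunc N f)).[b]).
Proof.
apply: ideal_trans (fps_eval_trunc phi f N Ib) _.
apply: ideal_sym; apply: ideal_trans (horner_map_trunc _ N) _.
rewrite -sumrB big1 => [|k _]; first exact: ideal_0.
by rewrite coef_poly ltn_ord subrr.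
Qed.

Lemma fps_eval_is_zmod_morphism : zmod_morphism (fps_eval phi b).
Proof.
move=> f g; apply: (ideal_eq (S := S)) => N.
apply: ideal_trans (fps_eval_trunc phi _ N Ib) _; apply: ideal_sym.
have -> : \sum_(k < N) phi ((f - g) k) * b ^+ k =
    \sum_(k < N) phi (f k) * b ^+ k - \sum_(k < N) phi (g k) * b ^+ k.
  by rewrite -sumrB; apply: eq_bigr => k _; rewrite fcoefB rmorphB mulrBl.
by rewrite opprD addrACA -opprD; apply: idealB; apply: fps_eval_trunc.
Qed.

(** Modulo ideal N both factors become polynomials evaluated at b, where evaluation is
    multiplicative, and the product of the truncations agrees with f * g in the coefficients below
    N. *)
Lemma fps_eval_is_monoid_morphism : monoid_morphism (fps_eval phi b).
Proof.
split=> [|f g]; apply: (ideal_eq (S := S)) => N.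
  (* One level more than asked, so that the partial sum has its k = 0 term even for N = 0. *)
  apply: (@ideal_le _ _ N N.+1) => //.
  apply: ideal_trans (fps_eval_trunc phi _ _ Ib) _.
  rewrite big_ord_recl big1 => [|k _]; last by rewrite fcoef1 rmorph0 mul0r.
  by rewrite fcoef1 rmorph1 mulr1 addr0 subrr; apply: ideal_0.
apply: ideal_trans (fps_eval_trunc phi _ N Ib) _; apply: ideal_sym.
apply: ideal_trans (ideal_congM (fps_eval_horner f N) (fps_eval_horner g N)) _.
rewrite -hornerM -rmorphM /=.
apply: ideal_trans (horner_map_trunc _ N) _.
rewrite -sumrB big1 => [|k _]; first exact: ideal_0.
by rewrite -fps_mul_trunc ?subrr.
Qed.

Definition fps_evalr : {rmorphism fps A -> B} := HB.pack (fps_eval phi b)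
  (GRing.isZmodMorphism.Build (fps A) B _ fps_eval_is_zmod_morphism)
  (GRing.isMonoidMorphism.Build (fps A) B _ fps_eval_is_monoid_morphism).

Lemma fps_eval_const a : fps_eval phi b (fps_const a) = phi a.
Proof.
apply: (ideal_eq (S := S)) => N; apply: (@ideal_le _ _ N N.+1) => //.
apply: ideal_trans (fps_eval_trunc phi _ _ Ib) _.
rewrite big_ord_recl big1 => [|k _]; last by rewrite /= rmorph0 mul0r.
by rewrite mulr1 addr0 subrr; apply: ideal_0.
Qed.

Lemma fps_evalX : fps_eval phi b (fps_X A) = b.
Proof.
apply: (ideal_eq (S := S)) => N; apply: (@ideal_le _ _ N N.+2) => //.
  by rewrite -addn2 leq_addr.
apply: ideal_trans (fps_eval_trunc phi _ _ Ib) _.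
rewrite 2!big_ord_recl big1 => [|k _]; last by rewrite /= rmorph0 mul0r.
by rewrite /= rmorph0 mul0r add0r rmorph1 mul1r addr0 subrr; apply: ideal_0.
Qed.

Lemma fps_eval_ideal (f : fps A) : f 0%N = 0 -> I 1 (fps_eval phi b f).
Proof.
move=> f0; have := fps_eval_trunc phi f 1 Ib.
by rewrite big_ord_recl big_ord0 f0 rmorph0 mul0r addr0 subr0.
Qed.

End Evaluation.

(** Continuity comes for free: the remainder of f after N terms is a multiple of X^N, and psi sends
    it into ideal N because psi X is in ideal 1. *)
Lemma fps_eval_unique (A B : comNzRingType) (S : adic B) (psi : {rmorphism fps A -> B}) :
  ideal S 1 (psi (fps_X A)) ->
  psi =1 fps_eval S (psi \o @fps_const A) (psi (fps_X A)).
Proof.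
move=> Ib f; apply: (ideal_eq (S := S)) => N; apply: ideal_sym.
apply: ideal_trans (fps_eval_trunc _ _ N Ib) _; apply: ideal_sym.
rewrite {1}(fps_split f N) rmorphD rmorph_sum rmorphM rmorphXn /= addrAC.
rewrite -sumrB big1 => [|k _]; last by rewrite rmorphM rmorphXn subrr.
by rewrite add0r; apply/ideal_mulr/idealX.
Qed.

Section Substitution.
Variables (K B : comNzRingType) (S : adic B) (c : {rmorphism K -> B}).
Implicit Types (a b : B) (f g : fps K) (F : fps (fps K)).
Local Notation I := (ideal S).

Definition ev1 a f := fps_eval S c a f.
Definition ev2 a b F := fps_eval S (ev1 a) b F.

Definition ev1r a (Ia : I 1 a) : {rmorphism fps K -> B} := fps_evalr c Ia.
Definition ev2r a b (Ia : I 1 a) (Ib : I 1 b) : {rmorphism fps (fps K) -> B} :=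
  fps_evalr (ev1r Ia) Ib.

Lemma ev2_trunc a b F N : I 1 a -> I 1 b ->
  I N (ev2 a b F - \sum_(j < N) \sum_(i < N) c (F j i) * a ^+ i * b ^+ j).
Proof.
move=> Ia Ib; apply: ideal_trans (fps_eval_trunc (ev1r Ia) F N Ib) _.
rewrite -sumrB; apply: ideal_sum => j _; rewrite -mulr_suml -mulrBl.
exact/ideal_mulr/fps_eval_trunc.
Qed.

(** Links the sum over pairs that defines [subst2] and [subst3] with iterated evaluation: modulo
    ideal N both are the sum over the N by N square. *)
Lemma tsum_ev2 a b F : I 1 a -> I 1 b ->
  tsum S (fun ij : nat * nat => c (F ij.2 ij.1) * a ^+ ij.1 * b ^+ ij.2) = ev2 a b F.
Proof.
move=> Ia Ib; apply: (ideal_eq (S := S)) => N.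
apply: ideal_trans (ideal_sym (ev2_trunc F N Ia Ib)).
pose s := fun i j : nat => c (F j i) * a ^+ i * b ^+ j.
have := @tsum_seq _ S _ (fun ij : nat * nat => s ij.1 ij.2)
  [seq (i, j) | i <- iota 0 N, j <- iota 0 N] N.
rewrite (big_allpairs (F := fun ij => s ij.1 ij.2)) /= exchange_big /=.
rewrite -[N in iota 0 N]subn0 -/(index_iota 0 N) big_mkord.
under [X in _ - X]eq_bigr do rewrite big_mkord.
apply; first by rewrite allpairs_uniq ?iota_uniq // => -[i j] [k l] _ _ [-> ->].
move=> [i j] nI; apply/allpairsP; exists (i, j) => /=.
rewrite !mem_index_iota /=; split=> //; case: ltnP => // Ni; case: nI.
  by rewrite /s /=; apply: ideal_mulr; apply: ideal_mull; apply: idealX.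
by rewrite /s /=; apply/ideal_mull/idealX.
Qed.

Lemma ev1_unique (psi : {rmorphism fps K -> B}) a f : I 1 a ->
  (forall k, psi (fps_const k) = c k) -> psi (fps_X K) = a -> psi f = ev1 a f.
Proof.
move=> Ia psic psiX; rewrite (fps_eval_unique (S := S)) ?psiX //.
by rewrite (_ : _ \o _ = c) //; apply/funext.
Qed.

Lemma ev2_unique (psi : {rmorphism fps (fps K) -> B}) a b F : I 1 a -> I 1 b ->
  (forall k, psi (const2 k) = c k) -> psi (fps_const (fps_X K)) = a ->
  psi (fps_X (fps K)) = b -> psi F = ev2 a b F.
Proof.
move=> Ia Ib psic psix psiy; rewrite (fps_eval_unique (S := S)) ?psiy //.
rewrite (_ : _ \o _ = ev1 a) //; apply/funext => f.
exact: (@ev1_unique (psi \o @fps_const (fps K))).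
Qed.

Lemma ev1_const a k : I 1 a -> ev1 a (fps_const k) = c k.
Proof. by move=> Ia; apply: (fps_eval_const c Ia). Qed.

Lemma ev1_X a : I 1 a -> ev1 a (fps_X K) = a.
Proof. by move=> Ia; apply: (fps_evalX c Ia). Qed.

Lemma ev2_const a b k : I 1 a -> I 1 b -> ev2 a b (const2 k) = c k.
Proof. by move=> Ia Ib; rewrite -(ev1_const k Ia); apply: (fps_eval_const (ev1r Ia) Ib). Qed.

Lemma ev2_x a b f : I 1 a -> I 1 b -> ev2 a b (fps_const f) = ev1 a f.
Proof. by move=> Ia Ib; apply: (fps_eval_const (ev1r Ia) Ib). Qed.

Lemma ev2_Y a b : I 1 a -> I 1 b -> ev2 a b (fps_X (fps K)) = b.
Proof. by move=> Ia Ib; apply: (fps_evalX (ev1r Ia) Ib). Qed.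

Lemma ev2_y a b f : I 1 a -> I 1 b -> ev2 a b (fps_map (@fps_const K) f) = ev1 b f.
Proof.
move=> Ia Ib.
apply: (@ev1_unique (ev2r Ia Ib \o fps_map (@fps_const K))) => //= [k|].
  by rewrite fps_map_const; apply: ev2_const.
by rewrite fps_mapX; apply: ev2_Y.
Qed.

Lemma ev1_0 f : ev1 0 f = c (f 0%N).
Proof.
symmetry; apply: (@ev1_unique (c \o @constant_term K)) => /= [|//|].
  exact: ideal_0.
exact: rmorph0.
Qed.

Lemma ev1_ideal a f : I 1 a -> f 0%N = 0 -> I 1 (ev1 a f).
Proof. by move=> Ia; apply: (fps_eval_ideal c Ia). Qed.

Lemma ev2_ideal a b F : I 1 a -> I 1 b -> F 0%N 0%N = 0 -> I 1 (ev2 a b F).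
Proof.
move=> Ia Ib F0; have := fps_eval_trunc (ev1r Ia) F 1 Ib.
rewrite big_ord_recl big_ord0 expr0 mulr1 addr0 => FN.
rewrite -[ev2 a b F](subrK (ev1 a (F 0%N))); apply: idealD; first exact: FN.
exact: ev1_ideal.
Qed.

End Substitution.

Section Composition.
Variables (K B B' : comNzRingType) (S : adic B) (S' : adic B').
Variables (c : {rmorphism K -> B}) (c' : {rmorphism K -> B'}) (phi : {rmorphism B -> B'}).
Hypothesis phic : forall k, phi (c k) = c' k.

(** Both sides are morphisms in f that agree on constants and on the variable. The compositions of
    substitutions below are reduced to this lemma or to [rmorph_ev2]. *)
Lemma rmorph_ev1 a f : ideal S 1 a -> ideal S' 1 (phi a) ->
  phi (ev1 S c a f) = ev1 S' c' (phi a) f.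
Proof.
move=> Ia Ia'; apply: (@ev1_unique _ _ _ _ (phi \o ev1r c Ia)) => //= [k|].
  by rewrite [X in phi X]ev1_const ?phic.
by rewrite [X in phi X]ev1_X.
Qed.

Lemma rmorph_ev2 a b F : ideal S 1 a -> ideal S 1 b ->
  ideal S' 1 (phi a) -> ideal S' 1 (phi b) ->
  phi (ev2 S c a b F) = ev2 S' c' (phi a) (phi b) F.
Proof.
move=> Ia Ib Ia' Ib'.
apply: (@ev2_unique _ _ _ _ (phi \o ev2r c Ia Ib)) => //= [k||].
- by rewrite [X in phi X]ev2_const ?phic.
- by rewrite [X in phi X]ev2_x ?ev1_X.
- by rewrite [X in phi X]ev2_Y.
Qed.

End Composition.

(** * The filtered rings of power series in one, two and three variables *)

Section PowerSeries.
Variable K : comNzRingType.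

HB.instance Definition _ := GRing.RMorphism.copy (@const2 K)
  (@fps_const (fps K) \o @fps_const K).
HB.instance Definition _ := GRing.RMorphism.copy (@const3 K)
  (@fps_const (fps (fps K)) \o @const2 K).

Definition S1 := adic_fps (adic_base K).
Definition S2 := adic_fps S1.
Definition S3 := adic_fps S2.

Lemma idealS1 (f : fps K) : ideal S1 1 f <-> f 0%N = 0.
Proof. by split=> [/(_ 0%N)/(_ isT)|f0 [|n]]. Qed.

Lemma ideal_fps1 (B : comNzRingType) (S : adic B) (f : fps B) :
  ideal (adic_fps S) 1 f <-> ideal S 1 (f 0%N).
Proof. by split=> [/(_ 0%N)|f0 [|n]] //; apply: idealT. Qed.

Lemma ideal_const1 (B : comNzRingType) (S : adic B) b :
  ideal S 1 b -> ideal (adic_fps S) 1 (fps_const b).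
Proof. by move=> Ib; apply/ideal_fps1. Qed.

Lemma ideal_X (B : comNzRingType) (S : adic B) : ideal (adic_fps S) 1 (fps_X B).
Proof. by apply/ideal_fps1; apply: ideal_0. Qed.

Lemma idealS2 (F : fps (fps K)) : ideal S2 1 F <-> F 0%N 0%N = 0.
Proof. by split=> [/ideal_fps1/idealS1|F0] //; apply/ideal_fps1/idealS1. Qed.

Lemma fps_comp_ev1 (f g : fps K) : fps_comp f g = ev1 S1 (@fps_const K) g f.
Proof. by []. Qed.
Lemma fps_comp2_ev1 (f : fps K) G : fps_comp2 f G = ev1 S2 (@const2 K) G f.
Proof. by []. Qed.

Lemma subst2_ev2 (F a b : fps (fps K)) : a 0%N 0%N = 0 -> b 0%N 0%N = 0 ->
  subst2 F a b = ev2 S2 (@const2 K) a b F.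
Proof. by move=> a0 b0; rewrite -tsum_ev2 //; apply/idealS2. Qed.

Lemma subst3_ev2 (F : fps (fps K)) a b : ideal S3 1 a -> ideal S3 1 b ->
  subst3 F a b = ev2 S3 (@const3 K) a b F.
Proof. by move=> Ia Ib; rewrite -tsum_ev2. Qed.

Lemma fps_comp_coef (f g : fps K) n : g 0%N = 0 ->
  fps_comp f g n = \sum_(k < n.+1) f k * (g ^+ k) n.
Proof.
move=> /idealS1 g0; apply/eqP; rewrite -subr_eq0; apply/eqP.
(* At level n + 1 the n-th coefficient falls in level 1 of the discrete filtration, so it is 0. *)
have /(_ n) := fps_eval_trunc (@fps_const K) f n.+1 g0.
rewrite subSnn fcoefB fcoef_sum => /(_ isT) e.
apply: etrans e; congr (_ - _); apply: eq_bigr => k _; rewrite fcoefM big_ord_recl subn0 big1 ?addr0 //.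
by move=> i _; rewrite mul0r.
Qed.

(** Write g = x u with u(0) = 1; then g^n = x^n u^n. *)
Lemma fcoef_exp_lead (g : fps K) n : g 0%N = 0 -> g 1%N = 1 -> (g ^+ n) n = 1.
Proof.
move=> g0 g1; pose u := Fps (fun n => g n.+1).
have -> : g = fps_X K * u.
  by apply/fpsP => -[|m]; rewrite -[fps_X K]expr1 fcoefXnM //= subn1.
rewrite exprMn fcoefXnM ltnn subnn -[LHS]/(constant_term (u ^+ n)) rmorphXn /constant_term /=.
by rewrite g1 expr1n.
Qed.

End PowerSeries.

(** * Compositional inverses *)

Lemma course_of_values (A : Type) (x0 : A) (step : nat -> (nat -> A) -> A) :
  (forall n f g, (forall k, (k < n)%N -> f k = g k) -> step n f = step n g) ->
  exists h, forall n, h n = step n h.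
Proof.
move=> stepE; pose app := fix app n : nat -> A :=
  if n is m.+1 then fun k => if (k < m)%N then app m k else step m (app m)
  else fun=> x0.
exists (fun n => app n.+1 n) => n; rewrite /= ltnn; apply: stepE.
elim: n => // n IHn k; rewrite ltnS leq_eqVlt => /orP[/eqP -> //|kn].
by rewrite [LHS]/= kn IHn.
Qed.

Section Inverse.
Variable K : comNzRingType.
Implicit Types f g h : fps K.

(** The equation h(g(x)) = x is a triangular system in the coefficients of h, with diagonal entries
    (g^n)_n = 1; solving row n for h_n gives the recursion. *)
Lemma comp_left_inverse g : g 0%N = 0 -> g 1%N = 1 ->
  exists h, [/\ h 0%N = 0, h 1%N = 1 & fps_comp h g = fps_X K].
Proof.
move=> g0 g1.
have [|h hE] := @course_of_values K 0 (fun n (h : nat -> K) =>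
    fps_X K n - \sum_(k < n) h k * (g ^+ k) n).
  by move=> n u v uv; congr (_ - _); apply: eq_bigr => k _; rewrite uv.
have h0 : h 0%N = 0 by rewrite hE big_ord0 subr0.
exists (Fps h); split=> //=.
  by rewrite hE big_ord_recl big_ord0 h0 mul0r addr0 subr0.
apply/fpsP => n; rewrite fps_comp_coef // big_ord_recr /= fcoef_exp_lead // mulr1.
by rewrite hE addrC subrK.
Qed.

Lemma fps_compA f g h : g 0%N = 0 -> h 0%N = 0 ->
  fps_comp (fps_comp f g) h = fps_comp f (fps_comp g h).
Proof.
move=> g0 h0; have Ih : ideal (S1 K) 1 h by apply/idealS1.
have Ig : ideal (S1 K) 1 g by apply/idealS1.
rewrite !fps_comp_ev1.
apply: (rmorph_ev1 (phi := ev1r (@fps_const K) Ih)) => //= [k|].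
  exact: (ev1_const (@fps_const K) k Ih).
exact: (ev1_ideal (@fps_const K) Ih g0).
Qed.

Lemma fps_compX g : g 0%N = 0 -> fps_comp (fps_X K) g = g.
Proof. by move/idealS1=> Ig; apply: (ev1_X (@fps_const K) Ig). Qed.

Lemma fps_comp_id f : fps_comp f (fps_X K) = f.
Proof.
symmetry; apply: (@ev1_unique _ _ (S1 K) (@fps_const K) (idfun : {rmorphism fps K -> fps K})) => //.
exact: ideal_X.
Qed.

(* The left inverse h of g has itself a left inverse g', and g' = g' h g = g. *)
Lemma compinvP g : g 0%N = 0 -> g 1%N = 1 ->
  [/\ compinv g 0%N = 0, fps_comp g (compinv g) = fps_X K
    & fps_comp (compinv g) g = fps_X K].
Proof.
move=> g0 g1; have [h [h0 h1 hg]] := comp_left_inverse g0 g1.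
have [g' [g'0 _ g'h]] := comp_left_inverse h0 h1.
have eg : g' = g.
  by rewrite -[LHS]fps_comp_id -hg -fps_compA // g'h fps_compX.
rewrite /compinv; case: xgetP => [h' _ //|/(_ h)[]].
by split=> //; rewrite -[in LHS]eg.
Qed.

End Inverse.

(** * The formal group F_g *)

Section FormalGroupChange.
Variables (K : comNzRingType) (F : fps (fps K)) (g : fps K).
Hypotheses (Fg : formal_group F) (g0 : g 0%N = 0) (g1 : g 1%N = 1).
Local Notation h := (compinv g).
Local Notation C1 := (@fps_const K).
Local Notation C2 := (@const2 K).
Local Notation C3 := (@const3 K).

Let h0 : h 0%N = 0. Proof. by case: (compinvP g0 g1). Qed.
Let gh : fps_comp g h = fps_X K. Proof. by case: (compinvP g0 g1). Qed.
Let hg : fps_comp h g = fps_X K. Proof. by case: (compinvP g0 g1). Qed.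

Lemma fg_coef00 : F 0%N 0%N = 0.
Proof. by rewrite (fg_x0 Fg). Qed.

Definition fg_at_g : fps (fps K) := subst2 F (fps_const g) (fps_map C1 g).

Let Igx : ideal (S2 K) 1 (fps_const g). Proof. exact/idealS2. Qed.
Let Igy : ideal (S2 K) 1 (fps_map C1 g). Proof. by apply/idealS2; rewrite /= g0. Qed.

Lemma fg_at_g_ev2 : fg_at_g = ev2 (S2 K) C2 (fps_const g) (fps_map C1 g) F.
Proof. by apply: subst2_ev2; rewrite /= ?g0. Qed.

Lemma fg_at_g_ideal : ideal (S2 K) 1 fg_at_g.
Proof. by rewrite fg_at_g_ev2; apply: (ev2_ideal C2 Igx Igy fg_coef00). Qed.

Section Eval.
Variables (B : comNzRingType) (S : adic B) (c : {rmorphism K -> B}).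

Lemma ev1_comp a (f f' : fps K) : ideal S 1 a -> f' 0%N = 0 ->
  ev1 S c a (fps_comp f f') = ev1 S c (ev1 S c a f') f.
Proof.
move=> Ia f'0; have If' : ideal (S1 K) 1 f' by apply/idealS1.
rewrite fps_comp_ev1; apply: (rmorph_ev1 (phi := ev1r c Ia)) => //= [k|].
  exact: (ev1_const c k Ia).
exact: (ev1_ideal c Ia f'0).
Qed.

Variables a b : B.
Hypotheses (Ia : ideal S 1 a) (Ib : ideal S 1 b).

Lemma ev2_fg_at_g : ev2 S c a b fg_at_g = ev2 S c (ev1 S c a g) (ev1 S c b g) F.
Proof.
have Ia' := ev1_ideal c Ia g0; have Ib' := ev1_ideal c Ib g0.
rewrite fg_at_g_ev2 -[ev1 S c a g](ev2_x c g Ia Ib) -[ev1 S c b g](ev2_y c g Ia Ib).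
apply: (rmorph_ev2 (phi := ev2r c Ia Ib)) => //= [k||].
- exact: (ev2_const c k Ia Ib).
- by rewrite [X in ideal _ _ X](ev2_x c g Ia Ib).
- by rewrite [X in ideal _ _ X](ev2_y c g Ia Ib).
Qed.

Lemma ev2_fg_at_g_ideal : ideal S 1 (ev2 S c a b fg_at_g).
Proof. by apply: (ev2_ideal c Ia Ib); apply/idealS2/fg_at_g_ideal. Qed.

Lemma ev2_fg_change : ev2 S c a b (fg_change F g) = ev1 S c (ev2 S c a b fg_at_g) h.
Proof.
rewrite -[fg_change F g]/(ev1 (S2 K) C2 fg_at_g h).
apply: (rmorph_ev1 (phi := ev2r c Ia Ib)) => /= [k||].
- exact: (ev2_const c k Ia Ib).
- exact: fg_at_g_ideal.
- exact: ev2_fg_at_g_ideal.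
Qed.

End Eval.

Lemma ev1_fg_change : ev1 (S2 K) C2 (fg_change F g) g = fg_at_g.
Proof.
have IG := fg_at_g_ideal.
by rewrite /fg_change fps_comp2_ev1 -/fg_at_g -(ev1_comp C2 g IG h0) gh (ev1_X C2 IG).
Qed.

(** The axioms in [formal_group] speak of coefficients and of [fps_map]. This lemma and the next
    three turn them into substitutions of (x, 0), (0, x), (x1, x2) and (x2, x3), to which
    [rmorph_ev2] applies. *)
Lemma fcoef0_ev2 (G : fps (fps K)) : G 0%N = ev2 (S1 K) C1 (fps_X K) 0 G.
Proof.
apply: (@ev2_unique _ _ _ _ (@constant_term (fps K))) => //.
exact: ideal_X.
Qed.

Lemma map_fcoef0_ev2 (G : fps (fps K)) :
  fps_map (fun p : fps K => p 0%N) G = ev2 (S1 K) C1 0 (fps_X K) G.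
Proof.
apply: (@ev2_unique _ _ _ _ (fps_map (@constant_term K))) => //.
- exact: ideal_X.
- by move=> k; apply: (fps_map_const (@constant_term K)).
- apply: etrans (fps_map_const (@constant_term K) _) _.
  exact: (rmorph0 (@fps_const K)).
- exact: (fps_mapX (@constant_term K)).
Qed.

Lemma fps_const_ev2 (G : fps (fps K)) :
  fps_const G = ev2 (S3 K) C3 (fps_const (fps_const (fps_X K))) (fps_const (fps_X (fps K))) G.
Proof.
apply: (@ev2_unique _ _ _ _ (@fps_const (fps (fps K)))) => //.
  exact/ideal_const1/ideal_const1/ideal_X.
exact/ideal_const1/ideal_X.
Qed.

Lemma map_const_ev2 (G : fps (fps K)) :
  fps_map (fps_map C1) G = ev2 (S3 K) C3 (fps_const (fps_X (fps K))) (fps_X (fps (fps K))) G.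
Proof.
apply: (@ev2_unique _ _ _ _ (fps_map (fps_map C1))) => //.
- exact/ideal_const1/ideal_X.
- exact: ideal_X.
- move=> k; apply: etrans (fps_map_const (fps_map C1) _) _.
  exact: (congr1 (@fps_const (fps (fps K))) (fps_map_const C1 k)).
- apply: etrans (fps_map_const (fps_map C1) _) _.
  exact: (congr1 (@fps_const (fps (fps K))) (fps_mapX C1)).
- exact: (fps_mapX (fps_map C1)).
Qed.

Lemma ev1_inv (B : comNzRingType) (S : adic B) (c : {rmorphism K -> B}) q :
  ideal S 1 q -> ev1 S c (ev1 S c q h) g = q.
Proof. by move=> Iq; rewrite -(ev1_comp c _ Iq h0) gh (ev1_X c Iq). Qed.

(** Since g(0) = 0, this is F(x, 0) = x with g(x) substituted for x. *)
Lemma fg_at_g_x0 : fg_at_g 0%N = g.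
Proof.
have I0 := ideal_0 (S1 K) 1; have IX := @ideal_X K (adic_base K).
have Ig : ideal (S1 K) 1 g by apply/idealS1.
have gX : ev1 (S1 K) C1 (fps_X K) g = g := fps_comp_id g.
have gg0 : ev1 (S1 K) C1 0 g = 0 by rewrite ev1_0 g0 rmorph0.
have Eg : ev1 (S1 K) C1 g (fps_X K) = g := ev1_X C1 Ig.
have E0 : ev1 (S1 K) C1 g 0 = 0 := rmorph0 (ev1r C1 Ig).
have Ec k : ev1r C1 Ig (fps_const k) = fps_const k := ev1_const C1 k Ig.
rewrite fcoef0_ev2 (ev2_fg_at_g C1 IX I0) gX gg0.
have e : ev1 (S1 K) C1 g (ev2 (S1 K) C1 (fps_X K) 0 F) =
    ev2 (S1 K) C1 (ev1 (S1 K) C1 g (fps_X K)) (ev1 (S1 K) C1 g 0) F.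
  apply: (rmorph_ev2 (phi := ev1r C1 Ig)) => //; first by rewrite [X in ideal _ _ X]Eg.
  by rewrite [X in ideal _ _ X]E0.
by rewrite Eg E0 -fcoef0_ev2 (fg_x0 Fg) Eg in e.
Qed.

(** Each axiom for F_g is the axiom for F at the series g(x_i), with g^-1 applied outside; in
    associativity the inner g^-1 cancels against g. *)
Lemma formal_group_change : formal_group (fg_change F g).
Proof.
have I0 := ideal_0 (S1 K) 1; have IX := @ideal_X K (adic_base K).
have Ig : ideal (S1 K) 1 g by apply/idealS1.
have gX : ev1 (S1 K) C1 (fps_X K) g = g := fps_comp_id g.
have gg0 : ev1 (S1 K) C1 0 g = 0 by rewrite ev1_0 g0 rmorph0.
have Eg : ev1 (S1 K) C1 g (fps_X K) = g := ev1_X C1 Ig.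
have E0 : ev1 (S1 K) C1 g 0 = 0 := rmorph0 (ev1r C1 Ig).
have Ec k : ev1r C1 Ig (fps_const k) = fps_const k := ev1_const C1 k Ig.
split.
- rewrite fcoef0_ev2 (ev2_fg_change C1 IX I0) -fcoef0_ev2 fg_at_g_x0.
  exact: hg.
- rewrite map_fcoef0_ev2 (ev2_fg_change C1 I0 IX) (ev2_fg_at_g C1 I0 IX) gX gg0.
  suff <- : g = ev2 (S1 K) C1 0 g F by exact: hg.
  have e : ev1 (S1 K) C1 g (ev2 (S1 K) C1 0 (fps_X K) F) =
      ev2 (S1 K) C1 (ev1 (S1 K) C1 g 0) (ev1 (S1 K) C1 g (fps_X K)) F.
    apply: (rmorph_ev2 (phi := ev1r C1 Ig)) => //; last by rewrite [X in ideal _ _ X]Eg.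
    by rewrite [X in ideal _ _ X]E0.
  by rewrite Eg E0 -map_fcoef0_ev2 (fg_0y Fg) Eg in e.
pose x1 : fps (fps (fps K)) := fps_const (fps_const (fps_X K)).
pose x2 : fps (fps (fps K)) := fps_const (fps_X (fps K)).
pose x3 : fps (fps (fps K)) := fps_X (fps (fps K)).
have I1 : ideal (S3 K) 1 x1 by exact/ideal_const1/ideal_const1/ideal_X.
have I2 : ideal (S3 K) 1 x2 by exact/ideal_const1/ideal_X.
have I3 : ideal (S3 K) 1 x3 by apply: ideal_X.
have J1 := ev1_ideal C3 I1 g0; have J2 := ev1_ideal C3 I2 g0.
have J3 := ev1_ideal C3 I3 g0.
have Fg0 : fg_change F g 0%N 0%N = 0.
  have : ideal (S2 K) 1 (fg_change F g) := ev1_ideal C2 fg_at_g_ideal h0.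
  by move/idealS2.
rewrite map_const_ev2 (fps_const_ev2 (fg_change F g)) -/x1 -/x2 -/x3.
have I12 := ev2_ideal C3 I1 I2 Fg0; have I23 := ev2_ideal C3 I2 I3 Fg0.
rewrite (subst3_ev2 _ I1 I23) (subst3_ev2 _ I12 I3).
rewrite (ev2_fg_change C3 I1 I23) (ev2_fg_change C3 I12 I3).
apply: (congr1 (fun q => ev1 (S3 K) C3 q h)).
apply: etrans (ev2_fg_at_g C3 I1 I23) _.
apply: etrans _ (esym (ev2_fg_at_g C3 I12 I3)).
have inner a b (Ia : ideal (S3 K) 1 a) (Ib : ideal (S3 K) 1 b) :
    ev1 (S3 K) C3 (ev2 (S3 K) C3 a b (fg_change F g)) g =
    ev2 (S3 K) C3 (ev1 (S3 K) C3 a g) (ev1 (S3 K) C3 b g) F.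
  rewrite (ev2_fg_change C3 Ia Ib) -(ev2_fg_at_g C3 Ia Ib).
  exact/ev1_inv/ev2_fg_at_g_ideal.
pose y1 := ev1 (S3 K) C3 x1 g; pose y2 := ev1 (S3 K) C3 x2 g.
pose y3 := ev1 (S3 K) C3 x3 g.
apply: etrans (congr1 (fun q => ev2 (S3 K) C3 y1 q F) (inner _ _ I2 I3)) _.
apply: etrans _ (congr1 (fun q => ev2 (S3 K) C3 q y3 F) (esym (inner _ _ I1 I2))).
rewrite -/y1 -/y2 -/y3.
(* [E3] replaces each x_i by g(x_i); it is applied to the associativity of F. *)
pose E3 : {rmorphism fps (fps (fps K)) -> fps (fps (fps K))} :=
  fps_evalr (ev2r C3 J1 J2) J3.
have E3c G : E3 (fps_const G) = ev2 (S3 K) C3 y1 y2 G.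
  exact: (fps_eval_const (ev2r C3 J1 J2) J3).
have Ek k : E3 (const3 k) = const3 k by rewrite E3c; apply: (ev2_const C3 k J1 J2).
have E1 : E3 x1 = y1 by rewrite E3c (ev2_x C3 _ J1 J2) (ev1_X C3 J1).
have E2 : E3 x2 = y2 := etrans (E3c _) (ev2_Y C3 J1 J2).
have E3' : E3 x3 = y3 := fps_evalX (ev2r C3 J1 J2) J3.
have K12 := ev2_ideal C3 I1 I2 fg_coef00; have K23 := ev2_ideal C3 I2 I3 fg_coef00.
have L12 := ev2_ideal C3 J1 J2 fg_coef00; have L23 := ev2_ideal C3 J2 J3 fg_coef00.
have := congr1 E3 (fg_assoc Fg).
rewrite map_const_ev2 (fps_const_ev2 F) -/x1 -/x2 -/x3.
have Esub a b a' b' : ideal (S3 K) 1 a -> ideal (S3 K) 1 b ->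
    E3 a = a' -> E3 b = b' -> ideal (S3 K) 1 a' -> ideal (S3 K) 1 b' ->
    E3 (ev2 (S3 K) C3 a b F) = ev2 (S3 K) C3 a' b' F.
  by move=> Ia Ib <- <- Ia' Ib'; exact: (rmorph_ev2 (S' := S3 K) (c' := C3) Ek F Ia Ib Ia' Ib').
have M12 := Esub _ _ _ _ I1 I2 E1 E2 J1 J2.
have M23 := Esub _ _ _ _ I2 I3 E2 E3' J2 J3.
rewrite (subst3_ev2 _ I1 K23) (subst3_ev2 _ K12 I3) => e.
apply: etrans (esym (Esub _ _ _ _ I1 K23 E1 M23 J1 L23)) _.
have M := Esub _ _ _ _ K12 I3 M12 E3' L12 J3.
refine (etrans e _).
exact: M.
Qed.

End FormalGroupChange.

(** * Kernels of substitutions *)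

Lemma ht_nat2 (p : nat * nat) : ht p = (p.1 + p.2)%N. Proof. by []. Qed.

Section Kernels.
Variable K : fieldType.

Lemma scale_neq0 (V : lmodType K) (k : K) (v : V) : k *: v <> 0 -> k <> 0 /\ v <> 0.
Proof. by move=> kv; split=> e; apply: kv; rewrite e ?scale0r ?scaler0. Qed.

Lemma mul_neq0 (x y : K) : x * y <> 0 -> x <> 0 /\ y <> 0.
Proof. by move=> xy; split=> e; apply: xy; rewrite e ?mul0r ?mulr0. Qed.

Lemma fsum_scaler (V : lmodType K) (T : choiceType) (ST : sized T) (k : K) (f : T -> V) N :
  (forall t, f t <> 0 -> (ht t <= N)%N) ->
  k *: (\sum_(t \in [set: T]) f t) = \sum_(t \in [set: T]) k *: f t.
Proof. exact: (fsum_morph (scaler0 _ k) (scalerDr k)). Qed.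

Lemma fsum_scalel (V : lmodType K) (T : choiceType) (ST : sized T) (f : T -> K) (v : V) N :
  (forall t, f t <> 0 -> (ht t <= N)%N) ->
  (\sum_(t \in [set: T]) f t) *: v = \sum_(t \in [set: T]) f t *: v.
Proof. exact: (fsum_morph (scale0r v) (fun k l => scalerDl v k l)). Qed.

(* The series in x^+-1, y^+-1 that get substituted are of two kinds, in
   V((x))((y)) and in V((y))((x)).  A kernel supported in [below false] sends x^p y^q
   into x^p y^q K[[x, y]] and acts on both; [below true] also allows the negative
   powers of x in the expansion of F(x, y)^p, and needs V((x))((y)). *)
Definition below (w : bool) (p q a b : int) : Prop :=
  q <= b /\ (if w then p + q <= a + b else p <= a).

Definition kernel := int -> int -> int -> int -> K.

Definition supported w (k : kernel) : Prop :=
  forall p q a b, k p q a b <> 0 -> below w p q a b.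

Section Transform.
Variable V : lmodType K.
Implicit Types (A C : int -> int -> V) (f : fps (fps K)).

(** This makes the sum in [transf] finite for a supported kernel: once p and q are bounded from
    below, [below] also bounds them from above. *)
Definition lower_finite w A : Prop := forall a b, exists N : nat,
  forall p q, below w p q a b -> A p q <> 0 -> - N%:Z <= p /\ - N%:Z <= q.

Definition transf (k : kernel) A (a b : int) : V :=
  \sum_(pq \in [set: int * int]) k pq.1 pq.2 a b *: A pq.1 pq.2.

Lemma lower_finiteW w A : lower_finite w A -> lower_finite false A.
Proof.
case: w => // lA a b; have [N NA] := lA a b; exists N => p q [qb pa].
by apply: NA; split => //; lia.
Qed.

Lemma fps2_scale_bound A a b : lower_finite false A ->
  exists N, forall i j : nat, A (a - i%:Z) (b - j%:Z) <> 0 -> (i + j <= N)%N.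
Proof.
move=> /(_ a b)[N NA]; exists (absz a + absz b + N + N)%N => i j.
by move=> /NA[|]; [split|]; lia.
Qed.

Lemma fps2_scaleD f f' A : lower_finite false A ->
  fps2_scale (f + f') A = fun a b => fps2_scale f A a b + fps2_scale f' A a b.
Proof.
move=> lA; apply/funext => a; apply/funext => b.
have [N NA] := fps2_scale_bound a b lA.
rewrite /fps2_scale -(fsumD (N := N)) => [|t]; last first.
  by case=> /scale_neq0[_ /NA].
by apply: eq_fsum => t; rewrite !fcoefD scalerDl.
Qed.

Lemma fps2_scale0 A : fps2_scale 0 A = fun a b => 0.
Proof.
by apply/funext => a; apply/funext => b; apply: fsum0 => t; rewrite scale0r.
Qed.

Lemma fps2_scale_sum (I : Type) (r : seq I) (f : I -> fps (fps K)) A a b :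
  lower_finite false A ->
  fps2_scale (\sum_(i <- r) f i) A a b = \sum_(i <- r) fps2_scale (f i) A a b.
Proof.
move=> lA; elim: r => [|i r IHr]; first by rewrite !big_nil fps2_scale0.
by rewrite !big_cons fps2_scaleD // IHr.
Qed.

Lemma fps2_scale_const c A a b : fps2_scale (const2 c) A a b = c *: A a b.
Proof.
rewrite /fps2_scale (@fsum1 _ _ _ (0%N, 0%N)) /= ?subr0 // => -[i j] /scale_neq0[].
by case: i j => [|i] [|j].
Qed.

Lemma fps2_mul_coef f f' (i j : nat) : (f * f') j i =
  \sum_(kl \in [set: nat * nat]) (if (kl.1 <= i)%N && (kl.2 <= j)%N
     then f kl.2 kl.1 * f' (j - kl.2)%N (i - kl.1)%N else 0).
Proof.
rewrite (fsum_ord2 (f := fun k l => if (k <= i)%N && (l <= j)%N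
     then f l k * f' (j - l)%N (i - k)%N else 0) (m := i.+1) (n := j.+1)).
  rewrite fcoefM fcoef_sum; apply: eq_bigr => l _; rewrite fcoefM.
  apply: eq_bigr => k _.
  by rewrite -ltnS ltn_ord -ltnS ltn_ord.
by move=> k l; rewrite !ltnS; case: andP.
Qed.

Lemma fps2_scaleM f f' A : lower_finite false A ->
  fps2_scale (f * f') A = fps2_scale f (fps2_scale f' A).
Proof.
move=> lA; apply/funext => a; apply/funext => b.
have [N NA] := fps2_scale_bound a b lA.
(* The convolution extended by zero, so that both indices range over full sets and the sums can be
   exchanged. *)
pose X (ij kl : nat * nat) : K := if (kl.1 <= ij.1)%N && (kl.2 <= ij.2)%N
     then f kl.2 kl.1 * f' (ij.2 - kl.2)%N (ij.1 - kl.1)%N else 0.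
transitivity (\sum_(ij \in [set: nat * nat]) \sum_(kl \in [set: nat * nat])
   X ij kl *: A (a - ij.1%:Z) (b - ij.2%:Z)).
  apply: eq_fsum => -[i j]; rewrite fps2_mul_coef.
  rewrite (fsum_scalel _ (N := (i + j)%N)) // => -[k l].
  by rewrite ht_nat2 /=; case: andP => // -[ki lj] _; rewrite leq_add.
rewrite (exchange_fsum (N := N)) => [|ij kl /scale_neq0[Xn /NA]]; last first.
  rewrite !ht_nat2 => le; split=> //; apply: leq_trans le.
  by move: Xn; rewrite /X; case: andP => // -[ki lj] _; rewrite leq_add.
apply: eq_fsum => -[k l] /=.
rewrite /fps2_scale (fsum_scaler _ (N := N)) => [|[i j] /scale_neq0[_]]; last first.
  rewrite ht_nat2 /= -!addrA -!opprD -!PoszD => /NA; apply: leq_trans.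
  by rewrite leq_add // leq_addl.
rewrite -(fsum_inj (h := fun ij : nat * nat => (ij.1 + k, ij.2 + l)%N)).
- apply: eq_fsum => -[i j]; rewrite /X /= !leq_addl /= !addnK scalerA.
  by rewrite !PoszD !opprD !addrA [a - i%:Z - _]addrAC [b - j%:Z - _]addrAC.
- by move=> [i j] [i' j'] /= [/addIn -> /addIn ->].
move=> [i j] /= /scale_neq0[]; rewrite /X /=; case: andP => // -[ki lj] _ _.
by exists (i - k, j - l)%N; rewrite /= !subnK.
Qed.

Lemma transf_lower_finite w k A : supported w k -> lower_finite w A ->
  lower_finite w (transf k A).
Proof.
move=> kw lA a b; have [N NA] := lA a b.
(* [below w] is transitive, so (p, q) is below (a, b). If w is true, r is only controlled through p
   + q <= r + s and s <= b, whence r >= - 2N - b. *)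
exists (N + N + absz b)%N => r s rsab /fsum_neq0[[p q]] /= /scale_neq0[/kw pqrs].
have pqab : below w p q a b by move: rsab pqrs; rewrite /below; case: w {kw lA NA}; lia.
move=> /(NA _ _ pqab); move: rsab pqrs; rewrite /below; case: w {kw lA NA pqab}; lia.
Qed.

Lemma transf_bound w k A a b : supported w k -> lower_finite w A ->
  exists N, forall p q, k p q a b <> 0 -> A p q <> 0 -> (absz p + absz q <= N)%N.
Proof.
move=> kw lA; have [N NA] := lA a b.
exists (absz a + absz b + 4 * N)%N => p q /kw pqab /(NA _ _ pqab).
move: pqab; rewrite /below; case: w {kw lA NA}; lia.
Qed.

End Transform.
End Kernels.

(** * Kernels acting as substitutions, their composition and uniqueness *)

Section KernelAlgebra.
Variable K : fieldType.
Implicit Types (k : kernel K) (f alpha beta : fps (fps K)).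

(* A row of a kernel, as a series with coefficients in the vector space K. *)
Definition krow k p q : int -> int -> K^o := k p q.

Record kernel_of w alpha beta k : Prop := KernelOf {
  kernel_supp : supported w k;
  kernel_x : forall p q, fps2_scale alpha (krow k p q) = krow k (p + 1) q;
  kernel_y : forall p q, fps2_scale beta (krow k p q) = krow k p (q + 1);
  kernel_1 : forall a b, k 0 0 a b = ((a == 0) && (b == 0))%:R
}.

Lemma kernel_ofW w alpha beta k : kernel_of w alpha beta k -> kernel_of true alpha beta k.
Proof.
move=> [ks kx ky k1]; split=> // p q a b /ks; rewrite /below.
by case: w {ks}; lia.
Qed.

Lemma krow_lower_finite w k p q : supported w k -> lower_finite w (krow k p q).
Proof.
move=> ks a b; exists (absz p + absz q + absz b)%N => r s rsab /ks.
by move: rsab; rewrite /below; case: w {ks}; lia.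
Qed.

Section Action.
Variables (w : bool) (alpha beta : fps (fps K)) (k : kernel K).
Hypotheses (Ia : ideal (S2 K) 1 alpha) (Ib : ideal (S2 K) 1 beta).
Hypothesis kk : kernel_of w alpha beta k.

Let ks : supported w k. Proof. exact: kernel_supp kk. Qed.
Let rowf p q : lower_finite false (krow k p q).
Proof. exact: lower_finiteW (krow_lower_finite p q ks). Qed.

Lemma kernel_monomial (i j : nat) p q :
  fps2_scale (alpha ^+ i * beta ^+ j) (krow k p q) = krow k (p + i%:Z) (q + j%:Z).
Proof.
rewrite fps2_scaleM //; have -> : fps2_scale (beta ^+ j) (krow k p q) = krow k p (q + j%:Z).
  elim: j q => [|j IHj] q.
    rewrite addr0 expr0; apply/funext => a; apply/funext => b.
    by rewrite -(rmorph1 (@const2 K)) fps2_scale_const scale1r.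
  rewrite exprS mulrC fps2_scaleM // (kernel_y kk) IHj.
  by rewrite -addrA -PoszD.
elim: i p => [|i IHi] p.
  rewrite addr0 expr0; apply/funext => a; apply/funext => b.
  by rewrite -(rmorph1 (@const2 K)) fps2_scale_const scale1r.
rewrite exprS mulrC fps2_scaleM // (kernel_x kk) IHi.
by rewrite -addrA -PoszD.
Qed.

(** For a monomial f this is [kernel_monomial]. In general f(alpha, beta) is a polynomial in alpha
    and beta up to terms of high total degree, which cannot reach the coefficient (a, b) of a
    row. *)
Lemma kernel_scale f p q a b :
  \sum_(ij \in [set: nat * nat]) f ij.2 ij.1 * k (p + ij.1%:Z) (q + ij.2%:Z) a b =
  fps2_scale (ev2 (S2 K) (@const2 K) alpha beta f) (krow k p q) a b.
Proof.
(* Large enough that the row (p, q) vanishes at (a - i, b - j) whenever i + j >= M, and that the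
   left-hand terms vanish outside the M by M square. *)
pose M := (4 * (absz a + absz b + absz p + absz q) + 4)%N.
rewrite (fsum_ord2 (f := fun i j => f j i * k (p + i%:Z) (q + j%:Z) a b)
  (m := M) (n := M)); last first.
  move=> i j nz; have /ks : k (p + i%:Z) (q + j%:Z) a b <> 0.
    by move=> k0; apply: nz; rewrite k0 mulr0.
  by rewrite /below /M; case: w; lia.
set E := ev2 _ _ _ _ _.
pose P := \sum_(j < M) \sum_(i < M) const2 (f j i) * alpha ^+ i * beta ^+ j.
have EP : ideal (S2 K) M (E - P) := ev2_trunc (@const2 K) f M Ia Ib.
have D0 : fps2_scale (E - P) (krow k p q) a b = 0.
  apply: fsum0 => -[i j]; case: (ltnP (i + j) M) => [ijM|Mij].
    have e : (E - P) j i = 0 by apply: (EP j i); rewrite -subnDA subn_gt0 addnC.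
    by rewrite [X in X *: _]e scale0r.
  apply: contrapT => /scale_neq0[_ /ks]; rewrite /below /=; move: Mij; rewrite /M.
  by case: (w); lia.
rewrite -[E](subrK P) fps2_scaleD // D0 add0r /P fps2_scale_sum //.
apply: eq_bigr => j _; rewrite fps2_scale_sum //; apply: eq_bigr => i _.
rewrite -mulrA fps2_scaleM // fps2_scale_const kernel_monomial.
by [].
Qed.

(** A substitution turns multiplication by f into multiplication by f(alpha, beta). Shifting (p, q)
    by (i, j) moves f from A onto the rows of the kernel, where [kernel_scale] applies. *)
Lemma transf_scale (V : lmodType K) f (A : int -> int -> V) : lower_finite w A ->
  transf k (fps2_scale f A) =
  fps2_scale (ev2 (S2 K) (@const2 K) alpha beta f) (transf k A).
Proof.
move=> lA; apply/funext => a; apply/funext => b.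
set E := ev2 _ _ _ _ _.
have [N NA] := lA a b.
(* A generous constant: [bound] serves all three exchanges of sums below, for both values of w. *)
pose M := (20 * (absz a + absz b + N + 1))%N.
have bound (p q : int) (i j : nat) : below w (p + i%:Z) (q + j%:Z) a b -> A p q <> 0 ->
    [/\ absz (p + i%:Z)%R + absz (q + j%:Z)%R <= M, absz p + absz q <= M & i + j <= M]%N.
  move=> pqab An; have lb : below w p q a b by move: pqab; rewrite /below; case: (w); lia.
  have := NA _ _ lb An; move: pqab; rewrite /below /M; case: (w) => h1 h2; split; lia.
transitivity (\sum_(pq \in [set: int * int]) \sum_(ij \in [set: nat * nat])
    (k pq.1 pq.2 a b * f ij.2 ij.1) *: A (pq.1 - ij.1%:Z) (pq.2 - ij.2%:Z)).
  apply: eq_fsum => -[p q] /=; have [kn|kn] := pselect (k p q a b <> 0); last first.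
    rewrite (contrapT kn) scale0r fsum0 // => ij.
    by rewrite mul0r scale0r.
  rewrite /fps2_scale (fsum_scaler _ (N := M)).
    by apply: eq_fsum => ij; rewrite scalerA.
  move=> [i j] /scale_neq0[_] /= An.
  by have [] := bound (p - i%:Z) (q - j%:Z) i j; rewrite ?subrK //; apply: ks.
rewrite (exchange_fsum (N := M)) => [|[p q] [i j] /= /scale_neq0[kn An]]; last first.
  have kn' : k p q a b <> 0 by move=> k0; apply: kn; rewrite k0 mul0r.
  by have [] := bound (p - i%:Z) (q - j%:Z) i j; rewrite ?subrK //; apply: ks.
transitivity (\sum_(ij \in [set: nat * nat]) \sum_(pq \in [set: int * int])
    (f ij.2 ij.1 * k (pq.1 + ij.1%:Z) (pq.2 + ij.2%:Z) a b) *: A pq.1 pq.2).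
  apply: eq_fsum => -[i j] /=.
  rewrite -(fsum_inj (h := fun pq : int * int => (pq.1 + i%:Z, pq.2 + j%:Z))).
  - by apply: eq_fsum => -[p q] /=; rewrite !addrK [f j i * _]mulrC.
  - by move=> [p q] [p' q'] /= [/addIr -> /addIr ->].
  by move=> [p q] _; exists (p - i%:Z, q - j%:Z); rewrite /= !subrK.
rewrite (exchange_fsum (N := M)) => [|[i j] [p q] /= /scale_neq0[kn An]]; last first.
  have kn' : k (p + i%:Z) (q + j%:Z) a b <> 0 by move=> k0; apply: kn; rewrite k0 mulr0.
  by have [] := bound _ _ _ _ (ks kn') An.
transitivity (\sum_(pq \in [set: int * int]) \sum_(ij \in [set: nat * nat])
    (E ij.2 ij.1 * k pq.1 pq.2 (a - ij.1%:Z) (b - ij.2%:Z)) *: A pq.1 pq.2).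
  apply: eq_fsum => -[p q] /=; pose M' := (20 * (absz a + absz b + absz p + absz q))%N.
  rewrite -(fsum_scalel _ (N := M')); last first.
    move=> [i j] /= nz; have /ks : k (p + i%:Z) (q + j%:Z) a b <> 0.
      by move=> k0; apply: nz; rewrite k0 mulr0.
    by rewrite /below /M' /=; case: (w); lia.
  rewrite -(fsum_scalel _ (N := M')); last first.
    move=> [i j] /= nz; have /ks : k p q (a - i%:Z) (b - j%:Z) <> 0.
      by move=> k0; apply: nz; rewrite k0 mulr0.
    by rewrite /below /M' /=; case: (w); lia.
  by rewrite kernel_scale.
rewrite (exchange_fsum (N := M)) => [|[p q] [i j] /= /scale_neq0[kn An]]; last first.
  have kn' : k p q (a - i%:Z) (b - j%:Z) <> 0 by move=> k0; apply: kn; rewrite k0 mulr0.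
  have lb : below w (p + i%:Z) (q + j%:Z) a b.
    by move: (ks kn'); rewrite /below; case: (w); lia.
  by have [] := bound _ _ _ _ lb An.
apply: eq_fsum => -[i j] /=.
have [N' NA'] := transf_bound (a - i%:Z) (b - j%:Z) ks lA.
rewrite /transf (fsum_scaler _ (N := N')).
  by apply: eq_fsum => pq; rewrite scalerA.
by move=> [p q] /scale_neq0[kn An]; apply: NA'.
Qed.

End Action.

Definition kernel_comp (k k' : kernel K) : kernel K := fun p q => transf k' (krow k p q).

(** Associativity of infinite matrix products: the intermediate (r, s) lies between (p, q) and (a,
    b) for [below true], which leaves finitely many choices. *)
Lemma transf_comp (V : lmodType K) k k' (C : int -> int -> V) :
  supported true k -> supported true k' -> lower_finite true C ->
  transf k' (transf k C) = transf (kernel_comp k k') C.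
Proof.
move=> ks ks' lC; apply/funext => a; apply/funext => b.
have [N NC] := lC a b; pose M := (20 * (absz a + absz b + N + 1))%N.
have bound p q r s : k' r s a b <> 0 -> k p q r s <> 0 -> C p q <> 0 ->
    (absz p + absz q <= M)%N /\ (absz r + absz s <= M)%N.
  by move=> /ks' + /ks + /(NC p q _); rewrite /below /M => h1 h2 h3; have := h3 _; lia.
transitivity (\sum_(rs \in [set: int * int]) \sum_(pq \in [set: int * int])
    (k' rs.1 rs.2 a b * k pq.1 pq.2 rs.1 rs.2) *: C pq.1 pq.2).
  apply: eq_fsum => -[r s] /=; have [kn|kn] := pselect (k' r s a b <> 0); last first.
    rewrite (contrapT kn) scale0r fsum0 // => pq.
    by rewrite mul0r scale0r.
  rewrite /transf (fsum_scaler _ (N := M)).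
    by apply: eq_fsum => pq; rewrite scalerA.
  by move=> [p q] /scale_neq0[kn' Cn]; case: (bound _ _ _ _ kn kn' Cn).
rewrite (exchange_fsum (N := M)) => [|[r s] [p q] /= /scale_neq0[/mul_neq0[kn kn'] Cn]]; last first.
  by have [] := bound _ _ _ _ kn kn' Cn.
apply: eq_fsum => -[p q] /=; have [Cn|Cn] := pselect (C p q <> 0); last first.
  rewrite (contrapT Cn) scaler0 fsum0 // => rs.
  by rewrite scaler0.
rewrite -(fsum_scalel _ (N := M)) // => -[r s] /= /mul_neq0[kn kn'].
by have [] := bound _ _ _ _ kn kn' Cn.
Qed.

Lemma kernel_compP alpha beta alpha' beta' k k' :
  ideal (S2 K) 1 alpha' -> ideal (S2 K) 1 beta' ->
  kernel_of true alpha beta k -> kernel_of true alpha' beta' k' ->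
  kernel_of true (ev2 (S2 K) (@const2 K) alpha' beta' alpha)
    (ev2 (S2 K) (@const2 K) alpha' beta' beta) (kernel_comp k k').
Proof.
move=> Ia' Ib' kk kk'; have ks := kernel_supp kk; have ks' := kernel_supp kk'.
split.
- move=> p q a b /fsum_neq0[[r s]] /= /(@scale_neq0 _ K^o)[/ks' + /ks].
  by rewrite /below; lia.
- move=> p q; rewrite [krow _ p q]/(transf k' (krow k p q)).
  rewrite -(transf_scale Ia' Ib' kk') ?(kernel_x kk) //.
  exact: krow_lower_finite ks.
- move=> p q; rewrite [krow _ p q]/(transf k' (krow k p q)).
  rewrite -(transf_scale Ia' Ib' kk') ?(kernel_y kk) //.
  exact: krow_lower_finite ks.
move=> a b; rewrite /kernel_comp /transf (@fsum1 _ _ _ (0, 0)) /=.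
  by rewrite /krow (kernel_1 kk) (kernel_1 kk') /= [_ *: _]mulr1.
move=> [r s] /= /(@scale_neq0 _ K^o)[_]; rewrite /krow (kernel_1 kk).
by case: eqP => [->|//]; case: eqP => [->|].
Qed.

Definition lower_bounded (A : int -> int -> K) :=
  exists N : nat, forall r s, A r s <> 0 -> - N%:Z <= s /\ - N%:Z <= r + s.

(** Induction on s, then on r for fixed s: the bound on s starts the outer induction and the bound
    on r + s the inner one. *)
Lemma lower_bounded_ind (A : int -> int -> K) : lower_bounded A ->
  (forall r s : int, (forall r' s' : int, s' < s -> A r' s' = 0) ->
     (forall r' : int, r' < r -> A r' s = 0) -> A r s = 0) ->
  forall r s, A r s = 0.
Proof.
move=> [N NA] step.
have main (n : nat) : forall s, s < n%:Z - N%:Z -> forall r, A r s = 0.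
  elim: n => [|n IHn] s sn r; first by apply: contrapT => /NA; lia.
  have [|sn'] := ltrP s (n%:Z - N%:Z); first by move/IHn; apply.
  have inner (m : nat) : forall r, r + s < m%:Z - N%:Z -> A r s = 0.
    elim: m => [|m IHm] r' rm; first by apply: contrapT => /NA; lia.
    apply: step => [r'' s'' ss|r'' rr]; first by apply: IHn; lia.
    by apply: IHm; lia.
  by apply: (inner (absz (r + s)%R + N + 1)%N); lia.
by move=> r s; apply: (main (absz s + N + 1)%N); lia.
Qed.

Lemma fps2_scaleB f (A A' : int -> int -> K^o) :
  lower_finite false A -> lower_finite false A' ->
  fps2_scale f (fun r s => A r s - A' r s) =
  fun a b => fps2_scale f A a b - fps2_scale f A' a b.
Proof.
move=> lA lA'; apply/funext => a; apply/funext => b.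
have [N NA] := fps2_scale_bound a b lA; have [N' NA'] := fps2_scale_bound a b lA'.
apply/eqP; rewrite eq_sym subr_eq; apply/eqP; rewrite /fps2_scale.
rewrite -(fsumD (N := (N + N')%N)) => [|[i j]].
  by apply: eq_fsum => t; rewrite -scalerDr subrK.
have big : A (a - i%:Z) (b - j%:Z) <> 0 \/ A' (a - i%:Z) (b - j%:Z) <> 0 ->
    (i + j <= N + N')%N by case=> [/NA|/NA']; lia.
case=> /scale_neq0[_ /= nz]; apply: big; last by right.
by apply: contrapT => /not_orP[/contrapT e /contrapT e']; apply: nz; rewrite e e' subr0.
Qed.

Section Unique.
Variables (alpha beta : fps (fps K)) (k k' : kernel K).
Hypotheses (a00 : alpha 0%N 0%N = 0) (a01 : alpha 0%N 1%N = 1).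
Hypotheses (b0 : forall i, beta 0%N i = 0) (b10 : beta 1%N 0%N = 1).
Hypotheses (kk : kernel_of true alpha beta k) (kk' : kernel_of true alpha beta k').

(** The coefficient (r + 1, s) of the product is A r s plus terms with smaller s, or with the same s
    and smaller r. *)
Lemma scale_x_inj (A : int -> int -> K^o) : lower_bounded A ->
  fps2_scale alpha A = (fun=> fun=> 0) -> forall r s, A r s = 0.
Proof.
move=> lA aA; apply: lower_bounded_ind => // r s Hs Hr.
have := congr1 (fun u : int -> int -> K^o => u (r + 1) s) aA; rewrite /fps2_scale (@fsum1 _ _ _ (1%N, 0%N)).
  by rewrite /= a01 scale1r addrK subr0.
move=> [i [|j]] /= /scale_neq0[ai]; last by rewrite Hs //; lia.
case: i ai => [|[|i]] // ai; rewrite subr0 Hr //; lia.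
Qed.

(** Same argument at the coefficient (r, s + 1). Here [b0] removes the entries A (r - i) (s + 1),
    out of reach of the induction. *)
Lemma scale_y_inj (A : int -> int -> K^o) : lower_bounded A ->
  fps2_scale beta A = (fun=> fun=> 0) -> forall r s, A r s = 0.
Proof.
move=> lA bA; apply: lower_bounded_ind => // r s Hs Hr.
have := congr1 (fun u : int -> int -> K^o => u r (s + 1)) bA; rewrite /fps2_scale (@fsum1 _ _ _ (0%N, 1%N)).
  by rewrite /= b10 scale1r addrK subr0.
move=> [i [|[|j]]] /= /scale_neq0[bi]; first by rewrite b0 in bi.
  by rewrite addrK; case: i bi => // i _; rewrite Hr //; lia.
by rewrite Hs //; lia.
Qed.

Let diff p q : int -> int -> K^o := fun r s => krow k p q r s - krow k' p q r s.

Let diffE f p q : fps2_scale f (diff p q) =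
  fun a b => fps2_scale f (krow k p q) a b - fps2_scale f (krow k' p q) a b.
Proof.
apply: fps2_scaleB; apply: (@lower_finiteW _ _ true); apply: krow_lower_finite.
  exact: kernel_supp kk.
exact: kernel_supp kk'.
Qed.

Let diff_bounded p q : lower_bounded (diff p q).
Proof.
exists (absz p + absz q)%N => r s.
have [e|/(kernel_supp kk)] := pselect (k p q r s = 0); last by rewrite /below; lia.
have [e'|/(kernel_supp kk')] := pselect (k' p q r s = 0); last by rewrite /below; lia.
by rewrite /diff /krow e e' subr0.
Qed.

Lemma kernel_unique : k = k'.
Proof.
have x_up p q : diff (p + 1) q = fps2_scale alpha (diff p q).
  by rewrite diffE (kernel_x kk) (kernel_x kk').
have y_up p q : diff p (q + 1) = fps2_scale beta (diff p q).
  by rewrite diffE (kernel_y kk) (kernel_y kk').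
have s0 f : fps2_scale f (fun=> fun=> 0 : K^o) = fun=> fun=> 0.
  by apply/funext => a; apply/funext => b; apply: fsum0 => t; rewrite scaler0.
have x_step p q : diff (p + 1) q = (fun=> fun=> 0) <-> diff p q = (fun=> fun=> 0).
  rewrite x_up; split=> [d|->//]; apply/funext => r; apply/funext => s.
  exact: scale_x_inj (diff_bounded p q) d r s.
have y_step p q : diff p (q + 1) = (fun=> fun=> 0) <-> diff p q = (fun=> fun=> 0).
  rewrite y_up; split=> [d|->//]; apply/funext => r; apply/funext => s.
  exact: scale_y_inj (diff_bounded p q) d r s.
have d0 : diff 0 0 = (fun=> fun=> 0).
  apply/funext => a; apply/funext => b.
  by rewrite /diff /krow (kernel_1 kk) (kernel_1 kk') subrr.
have dy q : diff 0 q = (fun=> fun=> 0).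
  elim/int_rec: q => [//|n IHn|n IHn].
    by rewrite -addn1 PoszD; apply/y_step.
  (* Going down to - (n + 1) uses the cancellation direction of [y_step]. *)
  by apply/y_step; rewrite -addn1 PoszD opprD subrK.
have dx p q : diff p q = (fun=> fun=> 0).
  elim/int_rec: p => [//|n IHn|n IHn].
    by rewrite -addn1 PoszD; apply/x_step.
  by apply/x_step; rewrite -addn1 PoszD opprD subrK.
apply/funext => p; apply/funext => q; apply/funext => a; apply/funext => b.
have := congr1 (fun u : int -> int -> K^o => u a b) (dx p q); rewrite /diff /krow => /eqP.
by rewrite subr_eq0 => /eqP.
Qed.

End Unique.

End KernelAlgebra.

(** * The kernels of (g(x), g(y)) and (F(x, y), y) *)

Section LaurentSeries.
Variable K : fieldType.
Implicit Types (z : laurent K) (p : fps K) (n a : int).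
Local Notation X := (tofrac (fps_X K)).

Lemma lcoef_shift p n a :
  lcoef (X ^ n * tofrac p) a = if a - n is Posz j then p j else 0.
Proof.
case: n => n; last by rewrite NegzE -exprnN lcoefE opprK.
rewrite -exprnP -tofracXn -tofracM -[tofrac _]mul1r.
have -> : (1 : laurent K) = X ^- 0 by rewrite expr0 invr1.
rewrite lcoefE addr0; case: a => j.
  rewrite fcoefXnM; case: ltnP => jn.
    by case e : (Posz j - Posz n) => [i|//]; lia.
  by rewrite subzn.
by case e : (Negz j - Posz n) => [i|//]; lia.
Qed.

Definition order_ge z n := exists p, z = X ^ n * tofrac p.

Lemma order_ge_exists z : exists n, order_ge z n.
Proof. by have [[k p] ->] := laurentP z; exists (- k%:Z), p; rewrite -exprnN. Qed.

Lemma order_ge_coef z n a : order_ge z n -> lcoef z a <> 0 -> n <= a.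
Proof. by move=> [p ->]; rewrite lcoef_shift; case e : (a - n) => [j|//]; lia. Qed.

Lemma order_ge_le z n m : m <= n -> order_ge z n -> order_ge z m.
Proof.
move=> mn [p ->]; exists (fps_X K ^+ absz (n - m) * p).
rewrite tofracM tofracXn mulrA exprnP -expfzDr ?tofrac_X_neq0 //.
by congr (X ^ _ * _); lia.
Qed.

Lemma order_geM z z' n n' : order_ge z n -> order_ge z' n' -> order_ge (z * z') (n + n').
Proof.
move=> [p ->] [p' ->]; exists (p * p').
by rewrite expfzDr ?tofrac_X_neq0 // tofracM mulrACA.
Qed.

Lemma order_ge0 n : order_ge 0 n.
Proof. by exists 0; rewrite tofrac0 mulr0. Qed.

Lemma order_ge_tofrac p : order_ge (tofrac p) 0.
Proof. by exists p; rewrite expr0z mul1r. Qed.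

Lemma order_geD z z' n : order_ge z n -> order_ge z' n -> order_ge (z + z') n.
Proof. by move=> [p ->] [p' ->]; exists (p + p'); rewrite tofracD mulrDr. Qed.

Lemma order_geN z n : order_ge z n -> order_ge (- z) n.
Proof. by move=> [p ->]; exists (- p); rewrite tofracN mulrN. Qed.

Lemma order_ge_sum (I : Type) (r : seq I) (P : pred I) (F : I -> laurent K) n :
  (forall i, P i -> order_ge (F i) n) -> order_ge (\sum_(i <- r | P i) F i) n.
Proof. by move=> Fn; elim/big_ind: _ => //; [apply: order_ge0|move=> *; apply: order_geD]. Qed.

Lemma lcoefD z z' a : lcoef (z + z') a = lcoef z a + lcoef z' a.
Proof.
have [n zn] := order_ge_exists z; have [n' zn'] := order_ge_exists z'.
have mn : Num.min n n' <= n by rewrite ge_min lexx.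
have mn' : Num.min n n' <= n' by rewrite ge_min lexx orbT.
have [p ->] := order_ge_le mn zn; have [p' ->] := order_ge_le mn' zn'.
rewrite -mulrDr -tofracD !lcoef_shift; case: (_ - _) => // j.
by rewrite addr0.
Qed.

Lemma lcoef0 a : lcoef (0 : laurent K) a = 0.
Proof. by apply: (addrI (lcoef 0 a)); rewrite -lcoefD !addr0. Qed.

Lemma lcoef_sum (I : Type) (r : seq I) (F : I -> laurent K) a :
  lcoef (\sum_(i <- r) F i) a = \sum_(i <- r) lcoef (F i) a.
Proof. by elim: r => [|i r IHr]; rewrite ?big_nil ?lcoef0 // !big_cons lcoefD IHr. Qed.

Lemma lcoef_tofrac p a : lcoef (tofrac p) a = if a is Posz j then p j else 0.
Proof. by have := lcoef_shift p 0 a; rewrite expr0z mul1r subr0. Qed.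

Lemma lcoef_1 a : lcoef (1 : laurent K) a = (a == 0)%:R.
Proof. by rewrite -tofrac1 lcoef_tofrac; case: a => // j; rewrite fcoef1. Qed.

Lemma lcoef_mulp p z a (M : nat) :
  (forall i : nat, lcoef z (a - i%:Z) <> 0 -> (i < M)%N) ->
  lcoef (tofrac p * z) a = \sum_(i < M) p i * lcoef z (a - i%:Z).
Proof.
have [n [q ->]] := order_ge_exists z.
rewrite mulrCA -tofracM lcoef_shift => zM.
(* Zero terms bring both sums to a common length. *)
transitivity (\sum_(i < (M + absz (a - n)%R + 1)%N)
    p i * lcoef (X ^ n * tofrac q) (a - i%:Z)); last first.
  rewrite -addnA big_split_ord /= [X in _ + X]big1 ?addr0 // => i _.
  apply: contrapT => nz; have : lcoef (X ^ n * tofrac q) (a - (M + i)%N%:Z) <> 0.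
    by move=> e; apply: nz; rewrite e mulr0.
  by move=> /zM; lia.
case e : (a - n) => [j|j]; last first.
  rewrite big1 // => i _; rewrite lcoef_shift.
  by case e' : (a - _ - n) => [l|l]; rewrite ?mulr0 //; lia.
rewrite fcoefM (_ : M + absz (Posz j) + 1 = j.+1 + M)%N; last by lia.
rewrite big_split_ord /= [X in _ + X]big1 ?addr0 => [|i _].
  apply: eq_bigr => i _; rewrite lcoef_shift.
  have -> : a - i%:Z - n = Posz (j - i) by have := ltn_ord i; lia.
  by [].
rewrite lcoef_shift.
by case e' : (a - _ - n) => [l|l]; rewrite ?mulr0 //; lia.
Qed.

End LaurentSeries.

Section BaseKernels.
Variable K : fieldType.
Local Notation X := (tofrac (fps_X K)).

Section Change.
Variables (g : fps K).
Hypotheses (g0 : g 0%N = 0) (g1 : g 1%N = 1).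

Lemma tofrac_g_neq0 : tofrac g != 0.
Proof.
by rewrite tofrac_eq0; apply/eqP => /fpsP/(_ 1%N)/eqP; rewrite g1 oner_eq0.
Qed.

(** Here g = x u with u a unit of K[[x]], so g^p = x^p u^p and u^p is a power series even for p <
    0. *)
Lemma order_ge_exp_g (p : int) : order_ge (tofrac g ^ p) p.
Proof.
pose u := Fps (fun n => g n.+1).
have gu : g = fps_X K * u.
  by apply/fpsP => -[|m]; rewrite -[fps_X K]expr1 fcoefXnM //= subn1.
have uu : u \is a GRing.unit by rewrite fps_unitE /= g1 unitr1.
exists (u ^ p); rewrite gu tofracM expfzMl; congr (_ * _).
case: p => n; first by rewrite -!exprnP tofracXn.
have tu0 : tofrac u ^+ n.+1 != 0.
  by rewrite expf_neq0 // tofrac_eq0; apply: contraTneq uu => ->; rewrite unitr0.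
rewrite NegzE -!exprnN; apply: (mulIf tu0).
by rewrite mulVf // -tofracXn -tofracM mulVr ?unitrX // tofrac1.
Qed.

Lemma lcoef_g_below (p a : int) : lcoef (tofrac g ^ p) a <> 0 -> p <= a.
Proof. exact/order_ge_coef/order_ge_exp_g. Qed.

Definition change_kernel : kernel K := fun p q a b =>
  lcoef (tofrac g ^ p) a * lcoef (tofrac g ^ q) b.

Lemma change_kernelP :
  kernel_of false (fps_const g) (fps_map (@fps_const K) g) change_kernel.
Proof.
have step (p a : int) : lcoef (tofrac g ^ (p + 1)) a =
    \sum_(i < (absz (a - p)%R).+1) g i * lcoef (tofrac g ^ p) (a - i%:Z).
  rewrite addrC expfzDr ?tofrac_g_neq0 // expr1z; apply: lcoef_mulp => i.
  by move=> /lcoef_g_below; lia.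
split.
- by move=> p q a b /mul_neq0[/lcoef_g_below pa /lcoef_g_below qb].
- move=> p q; apply/funext => a; apply/funext => b.
  rewrite /krow /change_kernel step mulr_suml /fps2_scale.
  pose f (i j : nat) : K := fps_const g j i *
    (lcoef (tofrac g ^ p) (a - i%:Z) * lcoef (tofrac g ^ q) (b - j%:Z)).
  rewrite [LHS](fsum_ord2 (f := f) (m := (absz (a - p)%R).+1) (n := 1%N)).
    rewrite big_ord_recl big_ord0 addr0; apply: eq_bigr => i _.
    by rewrite /f subr0 mulrA.
  move=> i j; rewrite /f => /mul_neq0[gj /mul_neq0[/lcoef_g_below pa _]]; split; first by lia.
  by case: j gj.
- move=> p q; apply/funext => a; apply/funext => b.
  rewrite /krow /change_kernel step mulr_sumr /fps2_scale.
  pose f (i j : nat) : K := fps_const (g j) i *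
    (lcoef (tofrac g ^ p) (a - i%:Z) * lcoef (tofrac g ^ q) (b - j%:Z)).
  rewrite [LHS](fsum_ord2 (f := f) (m := 1%N) (n := (absz (b - q)%R).+1)).
    apply: eq_bigr => j _; rewrite big_ord_recl big_ord0 addr0.
    by rewrite /f subr0 /= mulrCA.
  move=> i j; rewrite /f => /mul_neq0[gj /mul_neq0[_ /lcoef_g_below pa]]; split; last by lia.
  by case: i gj.
move=> a b; rewrite /change_kernel !expr0z !lcoef_1.
by case: (a == 0); case: (b == 0); rewrite /= ?mulr1 ?mulr0.
Qed.

End Change.

Section FormalGroup.
Variable F : fps (fps K).
Hypothesis F0 : F 0%N = fps_X K.
Local Notation T := (fps_map (@FracField.tofrac (fps K)) F).

Let Tunit : T \is a GRing.unit.
Proof. by rewrite fps_unitE /= F0 unitfE tofrac_X_neq0. Qed.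

(* z is in x0^m K[[x0, x2 / x0]]. *)
Definition weight_ge (z : fps (laurent K)) (m : int) := forall j : nat, order_ge (z j) (m - j%:Z).

Lemma weight_ge_mul z z' m m' : weight_ge z m -> weight_ge z' m' -> weight_ge (z * z') (m + m').
Proof.
move=> zm zm' j; rewrite fcoefM; apply: order_ge_sum => i _.
apply: order_ge_le (order_geM (zm i) (zm' (j - i)%N)).
by have := ltn_ord i; lia.
Qed.

Lemma weight_ge_1 : weight_ge 1 0.
Proof.
move=> j; rewrite fcoef1 sub0r; case: j => [|j]; last exact: order_ge0.
by rewrite /= -tofrac1; apply: order_ge_tofrac.
Qed.

Lemma weight_ge_exp z m n : weight_ge z m -> weight_ge (z ^+ n) (m *+ n).
Proof.
move=> zm; elim: n => [|n IHn]; first exact: weight_ge_1.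
by rewrite exprS mulrS; apply: weight_ge_mul.
Qed.

Lemma weight_ge_T : weight_ge T 1.
Proof.
move=> [|j] /=.
  by rewrite F0; exists 1; rewrite tofrac1 mulr1 expr1z.
by apply: order_ge_le (order_ge_tofrac _); lia.
Qed.

(** The coefficient of x2^j in T T^-1 = 1 expresses x0 times the j-th coefficient of T^-1 by the
    earlier ones, multiplied by elements of K[[x0]]; hence a strong induction. *)
Lemma weight_ge_TV : weight_ge T^-1 (-1).
Proof.
move=> j; elim/ltn_ind: j => j IHj.
have /fpsP/(_ j) : T * T^-1 = 1 by rewrite mulrV.
rewrite fcoefM big_ord_recl subn0 /= F0 => /(canRL (addrK _)) Tj.
have [p rp] : order_ge (X * T^-1 j) (- j%:Z).
  rewrite Tj; apply: order_geD.
    by have := weight_ge_1 j; rewrite sub0r.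
  apply/order_geN/order_ge_sum => i _.
  apply: order_ge_le (order_geM (order_ge_tofrac _) (IHj _ _)).
    by have := ltn_ord i; rewrite /bump /=; lia.
  by have := ltn_ord i; rewrite /bump /=; lia.
exists p; apply: (mulfI (tofrac_X_neq0 K)); rewrite rp mulrA.
rewrite -[X in X * _ * _]expr1z -expfzDr ?tofrac_X_neq0 //.
by congr (X ^ _ * _); lia.
Qed.

Lemma weight_ge_pow (m : int) : weight_ge (fg_pow F m) m.
Proof.
rewrite /fg_pow; case: m => n; first by rewrite -exprnP -[Posz n]natz; apply: weight_ge_exp weight_ge_T.
rewrite NegzE -exprnN -exprVn.
have -> : - (n.+1)%:Z = -1 *+ n.+1 by rewrite mulNrn natz.
exact: weight_ge_exp weight_ge_TV.
Qed.

Definition fg_kernel : kernel K := fun p q a b => lcoef2 (fg_pow F p) a (b - q).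

Lemma fg_kernelP : kernel_of true F (fps_X (fps K)) fg_kernel.
Proof.
have supp : supported true fg_kernel.
  move=> p q a b; rewrite /fg_kernel /lcoef2 /below.
  by case e : (b - q) => [j|//] /(order_ge_coef (weight_ge_pow p j)); lia.
split=> //.
- move=> p q; apply/funext => a; apply/funext => b; rewrite /fps2_scale /krow.
  pose f (i j : nat) : K := F j i * fg_kernel p q (a - i%:Z) (b - j%:Z).
  pose M := (absz a + absz b + absz p + absz q + 1)%N.
  have fM i j : f i j <> 0 -> (i < M)%N /\ (j < (absz (b - q)%R).+1)%N.
    by move=> /mul_neq0[_ /supp]; rewrite /below /M; lia.
  rewrite [LHS](fsum_ord2 (f := f) fM) /fg_kernel /lcoef2.
  (* For b < q both sides vanish, the left one by the support condition. *)
  case e : (b - q) => [l|l]; last first.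
    rewrite big1 // => j _; rewrite big1 // => i _; apply: contrapT => /mul_neq0[_ /supp].
    by rewrite /below; lia.
  have -> : fg_pow F (p + 1) = T * fg_pow F p.
    by rewrite /fg_pow addrC exprzDr // expr1z.
  rewrite fcoefM lcoef_sum /=; apply: eq_bigr => j _.
  rewrite (@lcoef_mulp _ _ _ _ M) => [|i].
    apply: eq_bigr => i _; rewrite /f /fg_kernel /lcoef2.
    have -> : b - j%:Z - q = Posz (l - j) by have := ltn_ord j; lia.
    by [].
  by move=> /(order_ge_coef (weight_ge_pow p _)); rewrite /M; have := ltn_ord j; lia.
- move=> p q; apply/funext => a; apply/funext => b; rewrite /fps2_scale /krow.
  rewrite (@fsum1 _ _ _ (0%N, 1%N)) /=.
    by rewrite scale1r subr0 /fg_kernel opprD addrA addrAC.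
  move=> [i j] /(@scale_neq0 _ K^o)[+ _].
  by case: j i => [|[|j]] [|i].
move=> a b; rewrite /fg_kernel /fg_pow expr0z subr0 /lcoef2.
case: b => [j|j]; last by rewrite andbF.
rewrite fcoef1; case: j => [|j]; first by rewrite lcoef_1 andbT.
by rewrite lcoef0 andbF.
Qed.

End FormalGroup.
End BaseKernels.

(** * Vertex algebras *)

Lemma fcoef_constM (A : comNzRingType) (a : A) (f : fps A) n :
  (fps_const a * f) n = a * f n.
Proof. by rewrite fcoefM big_ord_recl subn0 big1 ?addr0 // => i _; rewrite mul0r. Qed.

Section DividedDifference.
Variable K : comNzRingType.
Local Notation x1 := (fps_const (fps_X K)).
Local Notation x2 := (fps_X (fps K)).

(** The witness collects x^n - y^n = (x - y) sum_(i + j = n - 1) x^i y^j, weighted by h_n. *)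
Lemma divided_difference (h : fps K) :
  exists d : fps (fps K), (x1 - x2) * d = fps_const h - fps_map (@fps_const K) h.
Proof.
exists (Fps (fun j => Fps (fun i => h (i + j).+1))).
apply/fpsP => j; apply/fpsP => i.
rewrite mulrBl !fcoefB fcoef_constM -[x2]expr1 fcoefXnM -[fps_X K]expr1 fcoefXnM.
case: j i => [|j] [|i] /=; rewrite ?fcoef0 ?subr0 ?sub0r ?subrr ?subn1 ?addn0 ?add0n //.
by rewrite addnS subrr.
Qed.

(** Divide g^-1(x) - g^-1(y) by x - y, then substitute g(x) and g(y): the difference becomes x -
    y. *)
Lemma variable_difference (g : fps K) : g 0%N = 0 -> g 1%N = 1 ->
  exists d : fps (fps K),
    x1 - x2 = ev2 (S2 K) (@const2 K) (fps_const g) (fps_map (@fps_const K) g) (x1 - x2) * d.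
Proof.
move=> g0 g1; have [h0 _ hg] := compinvP g0 g1.
have Ig : ideal (S1 K) 1 g by apply/idealS1.
have Ix : ideal (S2 K) 1 (fps_const g) by apply/idealS2.
have Iy : ideal (S2 K) 1 (fps_map (@fps_const K) g) by apply/idealS2; rewrite /= g0.
have [d de] := divided_difference (compinv g).
pose E := ev2r (@const2 K) Ix Iy.
have hx : E (fps_const (compinv g)) = x1.
  apply: etrans (ev2_x (@const2 K) (compinv g) Ix Iy) _.
  rewrite -hg fps_comp_ev1; apply/esym.
  exact: (rmorph_ev1 (S' := S2 K) (c' := @const2 K) (phi := @fps_const (fps K))).
have hy : E (fps_map (@fps_const K) (compinv g)) = x2.
  apply: etrans (ev2_y (@const2 K) (compinv g) Ix Iy) _.
  apply: etrans (fps_mapX (@fps_const K)); rewrite -hg fps_comp_ev1; apply/esym.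
  apply: (rmorph_ev1 (S' := S2 K) (c' := @const2 K) (phi := fps_map (@fps_const K))) => //.
  by move=> k; apply: fps_map_const.
exists (E d); apply: etrans (rmorphM E (x1 - x2) d).
by rewrite de; apply: etrans (esym (rmorphB E _ _)); rewrite hx hy.
Qed.

End DividedDifference.

Section FormalGroupKernels.
Variables (K : fieldType) (F : fps (fps K)) (g : fps K).
Hypotheses (Fg : formal_group F) (g0 : g 0%N = 0) (g1 : g 1%N = 1).
Local Notation Fc := (fg_change F g).
Local Notation C2 := (@const2 K).

Let Ix : ideal (S2 K) 1 (fps_const g). Proof. exact/idealS2. Qed.
Let Iy : ideal (S2 K) 1 (fps_map (@fps_const K) g).
Proof. by apply/idealS2; rewrite /= g0. Qed.

(** As g^-1 has no constant term, g^-1(t) is t times a power series, here evaluated at t = F(g(x),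
    g(y)). *)
Lemma fg_change_factor : exists d, Fc = fg_at_g F g * d.
Proof.
have [h0 _ _] := compinvP g0 g1; set h := compinv g in h0.
have IG := fg_at_g_ideal Fg g0.
exists (ev1 (S2 K) C2 (fg_at_g F g) (Fps (fun n => h n.+1))).
have hE : h = fps_X K * Fps (fun n => h n.+1).
  by apply/fpsP => -[|m]; rewrite -[fps_X K]expr1 fcoefXnM //= subn1.
rewrite -[Fc]/(ev1r C2 IG h) {1}hE rmorphM; congr (_ * _).
exact: (ev1_X C2 IG).
Qed.

Lemma kernel_comp_change :
  kernel_comp (fg_kernel F) (change_kernel g) =
  kernel_comp (change_kernel g) (fg_kernel Fc).
Proof.
have Fcg := formal_group_change Fg g0 g1.
have kF := fg_kernelP (fg_x0 Fg); have kFc := fg_kernelP (fg_x0 Fcg).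
have kg := kernel_ofW (change_kernelP g0 g1).
have IFc : ideal (S2 K) 1 Fc by apply/idealS2; rewrite (fg_x0 Fcg).
have IY : ideal (S2 K) 1 (fps_X (fps K)) by apply: ideal_X.
have k1 := kernel_compP Ix Iy kF kg; have k2 := kernel_compP IFc IY kg kFc.
rewrite (ev2_Y C2 Ix Iy) -fg_at_g_ev2 // in k1.
rewrite (ev2_x C2 g IFc IY) (ev2_y C2 g IFc IY) ev1_fg_change // in k2.
have yg : ev1 (S2 K) C2 (fps_X (fps K)) g = fps_map (@fps_const K) g.
  apply/esym/(@ev1_unique _ _ _ _ (fps_map (@fps_const K))) => // [k|].
    exact: fps_map_const.
  exact: fps_mapX.
rewrite yg in k2; apply: kernel_unique k1 k2.
- by rewrite fg_at_g_x0.
- by rewrite fg_at_g_x0.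
- by case=> [|i]; rewrite /= ?g0.
by rewrite /= ?g1.
Qed.

End FormalGroupKernels.

Section VertexAlgebraChange.
Variables (K : fieldType) (V : lmodType K).
Implicit Types (Y : V -> int -> V -> V) (u v w vac : V).

Lemma finite_bound (T : eqType) (s : seq T) (P : T -> nat -> Prop) :
  (forall t M M', (M <= M')%N -> P t M -> P t M') ->
  (forall t, exists M, P t M) -> exists M, forall t, t \in s -> P t M.
Proof.
move=> mono ex; elim: s => [|t s [M IHs]]; first by exists 0%N.
have [M' tM'] := ex t; exists (M + M')%N => t'; rewrite inE => /orP[/eqP->|/IHs].
  by apply: mono tM'; rewrite leq_addl.
by apply: mono; rewrite leq_addr.
Qed.

(** This covers V((x))((y)): for given b only the finitely many q in [-N, b] matter, so the bounds
    on p can be made uniform. *)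
Lemma lower_finite_iter (A : int -> int -> V) :
  (exists N : nat, forall p q, A p q <> 0 -> - N%:Z <= q) ->
  (forall q, exists M : nat, forall p, A p q <> 0 -> - M%:Z <= p) ->
  lower_finite true A.
Proof.
move=> [N NA] MA a b.
have [M MAb] : exists M : nat, forall q, q \in box (N + absz b)%N ->
    forall p, A p q <> 0 -> - M%:Z <= p.
  by apply: finite_bound => // q M M' MM' + p Apq => /(_ p Apq); lia.
exists (M + N)%N => p q [qb _] Apq; have qN := NA _ _ Apq.
have : - M%:Z <= p by apply: MAb Apq; rewrite mem_box /=; lia.
by lia.
Qed.

Lemma lower_finite_swap (A : int -> int -> V) :
  lower_finite false A -> lower_finite false (fun p q => A q p).
Proof.
move=> lA a b; have [N NA] := lA b a; exists N => p q [qb pa] Aqp.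
by have [] := NA q p (conj pa qb) Aqp.
Qed.

Lemma transf_change_iter (g : fps K) (A : int -> int -> V) a b :
  g 0%N = 0 -> g 1%N = 1 -> lower_finite false A ->
  \sum_(p \in [set: int]) \sum_(q \in [set: int])
    (lcoef (tofrac g ^ p) a * lcoef (tofrac g ^ q) b) *: A p q =
  transf (change_kernel g) A a b.
Proof.
move=> g0 g1 lA; have ks := kernel_supp (change_kernelP g0 g1).
have [N NA] := transf_bound a b ks lA.
rewrite (pair_fsum (N := N)) // => p q /scale_neq0[kn An].
by have /= := NA _ _ kn An; lia.
Qed.

Lemma vprodF_transf (F : fps (fps K)) Y u v w :
  vprodF F Y u v w = transf (fg_kernel F) (vprod Y u v w).
Proof.
apply/funext => a; apply/funext => b; rewrite /vprodF.
rewrite -(fsum_inj (h := fun pq : int * int => (- pq.1 - 1, - pq.2 - 1))).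
- apply: eq_fsum => -[p q] /=; rewrite opprD !opprK addrK /fg_kernel /vprod.
  by rewrite addrA subrK.
- by move=> [p q] [p' q'] /= [/addIr/oppr_inj -> /addIr/oppr_inj ->].
move=> [m n] _; exists (- m - 1, - n - 1).
by rewrite /= !opprD !opprK !addrK.
Qed.

Section Operators.
Variables (F : fps (fps K)) (g : fps K) (Y : V -> int -> V -> V) (vac : V).
Hypotheses (g0 : g 0%N = 0) (g1 : g 1%N = 1).
Hypothesis Yv : nonlocal_vertex_algebra F Y vac.
Local Notation Yg := (vchange g Y).
Local Notation C2 := (@const2 K).

Let Yr0 v n : Y v n 0 = 0.
Proof. by have := va_linearr Yv v n (-1) 0 0; rewrite scaler0 addr0 scaleN1r addNr. Qed.
Let YrD v n : {morph Y v n : w w' / w + w'}.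
Proof. by move=> w w'; have := va_linearr Yv v n 1 w w'; rewrite !scale1r. Qed.
Let YrZ v n k w : Y v n (k *: w) = k *: Y v n w.
Proof. by have := va_linearr Yv v n k w 0; rewrite Yr0 !addr0. Qed.
Let Yl0 n w : Y 0 n w = 0.
Proof. by have := va_linearl Yv n w (-1) 0 0; rewrite scaler0 addr0 scaleN1r addNr. Qed.
Let YlD n w : {morph (fun v => Y v n w) : v v' / v + v'}.
Proof. by move=> v v'; have := va_linearl Yv n w 1 v v'; rewrite !scale1r. Qed.
Let YlZ n w k v : Y (k *: v) n w = k *: Y v n w.
Proof. by have := va_linearl Yv n w k v 0; rewrite Yl0 !addr0. Qed.

Lemma truncation_bound v w :
  exists N : nat, forall p : int, Y v (- p - 1) w <> 0 -> - N%:Z <= p.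
Proof.
have [N NY] := va_truncation Yv v w; exists (absz N) => p nz.
by rewrite leNgt; apply/negP => pN; apply: nz; apply: NY; lia.
Qed.

(** Indexing by the exponent p = - m - 1 instead of the mode m matches the rows of kernels. *)
Lemma vchangeE v w a :
  Yg v (- a - 1) w = \sum_(p \in [set: int]) lcoef (tofrac g ^ p) a *: Y v (- p - 1) w.
Proof.
rewrite /vchange -(fsum_inj (h := fun p : int => - p - 1)) //.
- by apply: eq_fsum => p; rewrite !opprD !opprK !addrK.
- by move=> p q /addIr/oppr_inj.
by move=> m _; exists (- m - 1); rewrite opprD !opprK addrK.
Qed.

Lemma vchange_bound v w a : exists N : nat, forall p : int,
  lcoef (tofrac g ^ p) a <> 0 -> Y v (- p - 1) w <> 0 -> (absz p <= N)%N.
Proof.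
have [N NY] := truncation_bound v w; exists (N + absz a)%N => p.
by move=> /(lcoef_g_below g0 g1) pa /NY; lia.
Qed.

Lemma vprod_lower_finite u v w : lower_finite true (vprod Y u v w).
Proof.
apply: lower_finite_iter => [|q]; last exact: truncation_bound.
have [N NY] := truncation_bound v w; exists N => p q nz; apply: NY => e.
by apply: nz; rewrite /vprod e Yr0.
Qed.

(** The iterate lies in V((x2))((x0)), so the roles of the variables are swapped and only the weaker
    finiteness survives. *)
Lemma viter_lower_finite u v w : lower_finite false (viter Y u v w).
Proof.
have : lower_finite true (fun p q => viter Y u v w q p).
  apply: lower_finite_iter => [|q]; last exact: truncation_bound.
  have [N NY] := truncation_bound u v; exists N => p q nz; apply: NY => e.
  by apply: nz; rewrite /viter e Yl0.
by move=> /lower_finiteW/lower_finite_swap.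
Qed.

Lemma vprod_change u v w : vprod Yg u v w = transf (change_kernel g) (vprod Y u v w).
Proof.
apply/funext => a; apply/funext => b; rewrite /vprod !vchangeE.
rewrite -transf_change_iter //; last exact: lower_finiteW (vprod_lower_finite u v w).
apply: eq_fsum => p; have [N NY] := vchange_bound v w b.
have YN q : lcoef (tofrac g ^ q) b *: Y v (- q - 1) w <> 0 -> (ht q <= N)%N.
  by case/scale_neq0 => kn Yn; apply: NY.
rewrite (fsum_morph (Yr0 _ _) (YrD _ _) YN) (fsum_scaler _ (N := N)).
  by apply: eq_fsum => q; rewrite YrZ scalerA.
move=> q nz; apply: YN => e; apply: nz.
by rewrite e Yr0.
Qed.

(** The exponents of x0 now sit in the inner sum, inside the first argument of [Y]: the sums are
    exchanged and linearity in that argument is used. *)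
Lemma viter_change u v w : viter Yg u v w = transf (change_kernel g) (viter Y u v w).
Proof.
apply/funext => a; apply/funext => b; rewrite /viter !vchangeE.
have lA := viter_lower_finite u v w.
have [N' NA] := transf_bound a b (kernel_supp (change_kernelP g0 g1)) lA.
rewrite -transf_change_iter // (exchange_fsum (N := N')) => [|p q]; last first.
  by case/scale_neq0 => kn An; have /= := NA _ _ kn An; lia.
apply: eq_fsum => q; have [N NY] := vchange_bound u v a.
have YN p : lcoef (tofrac g ^ p) a *: Y u (- p - 1) v <> 0 -> (ht p <= N)%N.
  by case/scale_neq0 => kn Yn; apply: NY.
rewrite (fsum_morph (Yl0 _ _) (@YlD _ _) YN) (fsum_scaler _ (N := N)).
  by apply: eq_fsum => p; rewrite YlZ scalerA mulrC.
move=> p nz; apply: YN => e; apply: nz.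
by rewrite e Yl0.
Qed.

Let vchange_boundn v w n : exists N : nat, forall p : int,
  lcoef (tofrac g ^ p) n *: Y v (- p - 1) w <> 0 -> (ht p <= N)%N.
Proof.
have [N NY] := vchange_bound v w n; exists N => p /scale_neq0[kn Yn].
exact: NY.
Qed.

Let modeE (n : int) : n = - (- n - 1) - 1.
Proof. by rewrite opprD !opprK addrK. Qed.

Lemma vchange_linearl n w : linear (fun v => Yg v n w).
Proof.
move=> k v v'; rewrite [n]modeE !vchangeE; set a := - n - 1.
have [N NY] := vchange_boundn v w a; have [N' NY'] := vchange_boundn v' w a.
rewrite (fsum_scaler _ NY) -(fsumD (N := (N + N')%N)).
  by apply: eq_fsum => p; rewrite YlD YlZ scalerDr !scalerA mulrC.
move=> p [nz|/NY' le]; last by rewrite (leq_trans le) ?leq_addl.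
have /NY le : lcoef (tofrac g ^ p) a *: Y v (- p - 1) w <> 0.
  by move=> e; apply: nz; rewrite e scaler0.
by rewrite (leq_trans le) ?leq_addr.
Qed.

Lemma vchange_linearr v n : linear (Yg v n).
Proof.
move=> k w w'; rewrite [n]modeE !vchangeE; set a := - n - 1.
have [N NY] := vchange_boundn v w a; have [N' NY'] := vchange_boundn v w' a.
rewrite (fsum_scaler _ NY) -(fsumD (N := (N + N')%N)).
  by apply: eq_fsum => p; rewrite YrD YrZ scalerDr !scalerA mulrC.
move=> p [nz|/NY' le]; last by rewrite (leq_trans le) ?leq_addl.
have /NY le : lcoef (tofrac g ^ p) a *: Y v (- p - 1) w <> 0.
  by move=> e; apply: nz; rewrite e scaler0.
by rewrite (leq_trans le) ?leq_addr.
Qed.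

Lemma nonlocal_change : formal_group F -> nonlocal_vertex_algebra (fg_change F g) Yg vac.
Proof.
move=> Fg; have kg := change_kernelP g0 g1; have ks := kernel_supp kg.
have Ix : ideal (S2 K) 1 (fps_const g) by apply/idealS2.
have Iy : ideal (S2 K) 1 (fps_map (@fps_const K) g).
  by apply/idealS2; rewrite /= g0.
split.
- exact: vchange_linearl.
- exact: vchange_linearr.
- move=> v w; have [N NY] := truncation_bound v w.
  (* A nonzero term would need - N <= p <= - n - 1. *)
  exists N%:Z => n Nn; rewrite [n]modeE vchangeE fsum0 // => p.
  apply: contrapT => /scale_neq0[/(lcoef_g_below g0 g1) pn /NY]; lia.
- move=> n w; rewrite [n in LHS]modeE vchangeE; set a := - n - 1.
  (* The vacuum has a single mode, paired with the exponent p = 0, and g^0 = 1. *)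
  rewrite (@fsum1 _ _ _ 0) => [|p /scale_neq0[_]].
    have -> : (n == -1) = (a == 0) by apply/eqP/eqP; rewrite /a; lia.
    rewrite expr0z lcoef_1 (va_vacuum Yv) oppr0 sub0r eqxx.
    by case: (a == 0); rewrite ?scale1r ?scale0r.
  by rewrite (va_vacuum Yv) subr_eq addNr oppr_eq0; case: eqP.
- move=> v n; rewrite [Posz n]modeE vchangeE fsum0 // => p.
  apply: contrapT => /scale_neq0[/(lcoef_g_below g0 g1) pn].
  have -> : - p - 1 = Posz (absz (- p - 1)) by lia.
  by rewrite (va_creation Yv).
(* For the constant coefficient, the order of g^p forces p <= 0 and creation forces p >= 0. *)
- move=> v; rewrite [-1]modeE vchangeE opprK subrr (@fsum1 _ _ _ 0).
    by rewrite expr0z lcoef_1 scale1r oppr0 sub0r (va_creation_lim Yv).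
  move=> p /scale_neq0[/(lcoef_g_below g0 g1) pn].
  have [->//|p0] := eqVneq p 0.
  have -> : - p - 1 = Posz (absz (- p - 1)) by lia.
  by rewrite (va_creation Yv).
move=> u v w; have [l lE] := va_weak_assoc Yv u v w; exists l.
have [d dE] := fg_change_factor Fg g0 g1.
have Fcg := formal_group_change Fg g0 g1.
have lC := vprod_lower_finite u v w; have lI := viter_lower_finite u v w.
have kF := fg_kernelP (fg_x0 Fg); have kFc := fg_kernelP (fg_x0 Fcg).
have lP : lower_finite false (vprodF F Y u v w).
  rewrite vprodF_transf; apply: (@lower_finiteW _ _ true).
  exact: transf_lower_finite (kernel_supp kF) lC.
have e : vprodF (fg_change F g) Yg u v w = transf (change_kernel g) (vprodF F Y u v w).
  rewrite !vprodF_transf vprod_change; have ks' := kernel_supp (kernel_ofW kg).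
  apply: etrans (transf_comp ks' (kernel_supp kFc) lC) _.
  apply: etrans _ (esym (transf_comp (kernel_supp kF) ks' lC)).
  exact: (congr1 (fun k => transf k _) (esym (kernel_comp_change Fg g0 g1))).
(* F_g^l is d^l times F(g(x), g(y))^l, and the latter factor is what multiplication by F^l becomes
   under the substitution. *)
have sF (A : int -> int -> V) : lower_finite false A ->
    fps2_scale (fg_change F g ^+ l) (transf (change_kernel g) A) =
    fps2_scale (d ^+ l) (transf (change_kernel g) (fps2_scale (F ^+ l) A)).
  move=> lA; rewrite (transf_scale Ix Iy kg _ lA) dE mulrC exprMn fps2_scaleM.
    by rewrite fg_at_g_ev2 // -(rmorphXn (ev2r C2 Ix Iy)).
  exact: transf_lower_finite ks lA.
move=> a b; rewrite e viter_change !sF //.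
suff -> : fps2_scale (F ^+ l) (vprodF F Y u v w) = fps2_scale (F ^+ l) (viter Y u v w).
  by [].
by apply/funext => a'; apply/funext => b'.
Qed.

Lemma weak_comm_change u v :
  (exists k : nat, forall w a b,
    let x1 := fps_const (fps_X K) in let x2 := fps_X (fps K) in
    fps2_scale ((x1 - x2) ^+ k) (vprod Y u v w) a b =
    fps2_scale ((x1 - x2) ^+ k) (fun a b => vprod Y v u w b a) a b) ->
  exists k : nat, forall w a b,
    let x1 := fps_const (fps_X K) in let x2 := fps_X (fps K) in
    fps2_scale ((x1 - x2) ^+ k) (vprod Yg u v w) a b =
    fps2_scale ((x1 - x2) ^+ k) (fun a b => vprod Yg v u w b a) a b.
Proof.
move=> [k kE]; exists k => w a b x1 x2.
have kg := change_kernelP g0 g1; have ks := kernel_supp kg.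
have Ix : ideal (S2 K) 1 (fps_const g) by apply/idealS2.
have Iy : ideal (S2 K) 1 (fps_map (@fps_const K) g).
  by apply/idealS2; rewrite /= g0.
have [d dE] := variable_difference g0 g1.
have sX (A : int -> int -> V) : lower_finite false A ->
    fps2_scale ((x1 - x2) ^+ k) (transf (change_kernel g) A) =
    fps2_scale (d ^+ k) (transf (change_kernel g) (fps2_scale ((x1 - x2) ^+ k) A)).
  move=> lA; rewrite (transf_scale Ix Iy kg _ lA) [in LHS]dE mulrC exprMn fps2_scaleM.
    by rewrite -(rmorphXn (ev2r C2 Ix Iy)).
  exact: transf_lower_finite ks lA.
have l1 := lower_finiteW (vprod_lower_finite u v w).
have l2 := lower_finite_swap (lower_finiteW (vprod_lower_finite v u w)).
(* The kernel of (g(x), g(y)) is invariant under exchanging the two variables, so it also acts on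
   the product in the opposite order. *)
have -> : (fun a b => vprod Yg v u w b a) =
    transf (change_kernel g) (fun a b => vprod Y v u w b a).
  apply/funext => a'; apply/funext => b'; rewrite vprod_change /transf.
  rewrite -(fsum_inj (h := fun pq : int * int => (pq.2, pq.1))).
  - by apply: eq_fsum => -[p q]; rewrite /change_kernel /= mulrC.
  - by move=> [p q] [p' q'] /= [-> ->].
  by move=> [p q] _; exists (q, p).
rewrite vprod_change !sX //.
suff -> : fps2_scale ((x1 - x2) ^+ k) (vprod Y u v w) =
    fps2_scale ((x1 - x2) ^+ k) (fun a b => vprod Y v u w b a) by [].
by apply/funext => a'; apply/funext => b'; apply: kE.
Qed.

End Operators.

Lemma vertex_algebra_change (F : fps (fps K)) (g : fps K) Y vac :
  formal_group F -> g 0%N = 0 -> g 1%N = 1 -> vertex_algebra F Y vac ->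
  vertex_algebra (fg_change F g) (vchange g Y) vac.
Proof.
move=> Fg g0 g1 [Yv Yc]; split; first exact: nonlocal_change Yv Fg.
by move=> u v; apply: (weak_comm_change g0 g1 Yv (Yc u v)).
Qed.

End VertexAlgebraChange.

Theorem proposition3p6 (R : realType) (F : fps (fps R[i])) (g : fps R[i])
    (V : lmodType R[i]) (Y : V -> int -> V -> V) (vac : V) :
  formal_group F -> g 0%N = 0 -> g 1%N = 1 ->
  formal_group (fg_change F g) /\
  (nonlocal_vertex_algebra F Y vac ->
     nonlocal_vertex_algebra (fg_change F g) (vchange g Y) vac) /\
  (vertex_algebra F Y vac ->
     vertex_algebra (fg_change F g) (vchange g Y) vac).
Proof.
move=> Fg g0 g1; split; first exact: formal_group_change.
split=> [Yv|]; first exact: nonlocal_change Yv Fg.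
exact: vertex_algebra_change.
Qed.
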